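(* Let $l$ be an odd prime. Let $d$ be a squarefree integer not equal to one such that $F=\mathbb{Q}(\sqrt{d})$ is an imaginary quadratic field with class number $h_F=l$. Let $L$ be the Hilbert class field of $F$ and let $\Delta_F$ be the discriminant of $F$. Let $p$ be an odd positive prime with $p\equiv 3\pmod 8$. Then the quaternion algebra $H_L(p,2)$ is a division algebra if and only if $\left(\frac{\Delta_F}{p}\right)=1$ or $d\equiv 1\pmod 8$.
   Context: For a field $F$ of characteristic $\neq 2$ and $a,b\in F\setminus\{0\}$, $H_F(a,b)$ denotes the generalized quaternion algebra over $F$ with basis $1,i,j,k$ and relations $i^2=a$, $j^2=b$, $ij=-ji=k$. $\left(\frac{m}{\ell}\right)$ is the Legendre symbol for an odd prime $\ell$, equal to $0$ if $\ell\mid m$. The discriminant of $\mathbb{Q}(\sqrt d)$ is $d$ if $d\equiv 1\pmod 4$ and $4d$ otherwise. *)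

(* Defs.v *)
From HB Require Import structures.
From mathcomp Require Import all_boot all_order all_fingroup all_algebra.
From mathcomp Require Import all_solvable all_field.
From mathcomp Require Import ring.
From mathcomp Require Import classical_sets functions cardinality.

Set Implicit Arguments.
Unset Strict Implicit.
Unset Printing Implicit Defensive.

Import Order.TTheory GRing.Theory Num.Theory.

Local Open Scope classical_set_scope.
Local Open Scope ring_scope.

(* [Quat x y z t : quat a b] stands for x + y i + z j + t k, where
   i ^ 2 = a, j ^ 2 = b and ij = - ji = k; this is the generalized quaternion
   algebra H_K(a, b) when K has characteristic other than 2 and a, b != 0. *)
Record quat (K : fieldType) (a b : K) :=
  Quat { quat1 : K; quati : K; quatj : K; quatk : K }.
Arguments Quat {K a b}.

Section QuaternionAlgebra.
Variables (K : fieldType) (a b : K).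
Local Notation H := (quat a b).

Definition tuple_of_quat (q : H) := (quat1 q, quati q, quatj q, quatk q).
Definition quat_of_tuple (t : K * K * K * K) : H :=
  let: (x, y, z, w) := t in Quat x y z w.
Lemma tuple_of_quatK : cancel tuple_of_quat quat_of_tuple.
Proof. by case. Qed.

HB.instance Definition _ := Choice.copy H (can_type tuple_of_quatK).

Lemma eq_quat (x y : H) : quat1 x = quat1 y -> quati x = quati y ->
  quatj x = quatj y -> quatk x = quatk y -> x = y.
Proof. by case: x y => ? ? ? ? [? ? ? ?] /= -> -> -> ->. Qed.

Definition addq (x y : H) : H :=
  Quat (quat1 x + quat1 y) (quati x + quati y)
       (quatj x + quatj y) (quatk x + quatk y).
Definition oppq (x : H) : H :=
  Quat (- quat1 x) (- quati x) (- quatj x) (- quatk x).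
Definition mulq (x y : H) : H :=
  let: Quat x1 xi xj xk := x in
  let: Quat y1 yi yj yk := y in
  Quat (x1 * y1 + a * (xi * yi) + b * (xj * yj) - a * b * (xk * yk))
       (x1 * yi + xi * y1 - b * (xj * yk) + b * (xk * yj))
       (x1 * yj + xj * y1 + a * (xi * yk) - a * (xk * yi))
       (x1 * yk + xk * y1 + xi * yj - xj * yi).
Definition scaleq (c : K) (x : H) : H :=
  Quat (c * quat1 x) (c * quati x) (c * quatj x) (c * quatk x).

Lemma addqA : associative addq.
Proof. by move=> x y z; apply: eq_quat; rewrite /= addrA. Qed.
Lemma addqC : commutative addq.
Proof. by move=> x y; apply: eq_quat; rewrite /= addrC. Qed.
Lemma add0q : left_id (Quat 0 0 0 0) addq.
Proof. by move=> x; apply: eq_quat; rewrite /= add0r. Qed.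
Lemma addNq : left_inverse (Quat 0 0 0 0) oppq addq.
Proof. by move=> x; apply: eq_quat; rewrite /= addNr. Qed.
HB.instance Definition _ := GRing.isZmodule.Build H addqA addqC add0q addNq.

Lemma mulqA : associative mulq.
Proof.
by move=> [? ? ? ?] [? ? ? ?] [? ? ? ?]; apply: eq_quat; rewrite /=; ring.
Qed.
Lemma mul1q : left_id (Quat 1 0 0 0) mulq.
Proof. by move=> [? ? ? ?]; apply: eq_quat; rewrite /=; ring. Qed.
Lemma mulq1 : right_id (Quat 1 0 0 0) mulq.
Proof. by move=> [? ? ? ?]; apply: eq_quat; rewrite /=; ring. Qed.
Lemma mulqDl : left_distributive mulq +%R.
Proof.
by move=> [? ? ? ?] [? ? ? ?] [? ? ? ?]; apply: eq_quat; rewrite /=; ring.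
Qed.
Lemma mulqDr : right_distributive mulq +%R.
Proof.
by move=> [? ? ? ?] [? ? ? ?] [? ? ? ?]; apply: eq_quat; rewrite /=; ring.
Qed.
Lemma oneq_neq0 : Quat 1 0 0 0 != 0 :> H.
Proof. by apply/eqP=> -[/eqP]; rewrite oner_eq0. Qed.
HB.instance Definition _ :=
  GRing.Zmodule_isNzRing.Build H mulqA mul1q mulq1 mulqDl mulqDr oneq_neq0.

Lemma scaleqA c d x : scaleq c (scaleq d x) = scaleq (c * d) x.
Proof. by apply: eq_quat; rewrite /= mulrA. Qed.
Lemma scale1q : left_id 1 scaleq.
Proof. by move=> x; apply: eq_quat; rewrite /= mul1r. Qed.
Lemma scaleqDr : right_distributive scaleq +%R.
Proof. by move=> c x y; apply: eq_quat; rewrite /= mulrDr. Qed.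
Lemma scaleqDl x : {morph scaleq^~ x : c d / c + d}.
Proof. by move=> c d; apply: eq_quat; rewrite /= mulrDl. Qed.
HB.instance Definition _ :=
  GRing.Zmodule_isLmodule.Build K H scaleqA scale1q scaleqDr scaleqDl.

Lemma scaleqAl (c : K) (x y : H) : c *: (x * y) = (c *: x) * y.
Proof. by case: x y => ? ? ? ? [? ? ? ?]; apply: eq_quat; rewrite /=; ring. Qed.
HB.instance Definition _ := GRing.Lmodule_isLalgebra.Build K H scaleqAl.
Lemma scaleqAr (c : K) (x y : H) : c *: (x * y) = x * (c *: y).
Proof. by case: x y => ? ? ? ? [? ? ? ?]; apply: eq_quat; rewrite /=; ring. Qed.
HB.instance Definition _ := GRing.Lalgebra_isAlgebra.Build K H scaleqAr.

Definition rV_of_quat (x : H) : 'rV[K]_4 :=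
  \row_(n < 4) [:: quat1 x; quati x; quatj x; quatk x]`_n.
Lemma quat_vect : Vector.axiom 4 H.
Proof.
exists rV_of_quat => [c x y|].
  by apply/rowP; case=> [[|[|[|[|//]]]] ?]; rewrite !mxE.
exists (fun v : 'rV_4 => Quat (v ord0 (@Ordinal 4 0 isT))
    (v ord0 (@Ordinal 4 1 isT)) (v ord0 (@Ordinal 4 2 isT))
    (v ord0 (@Ordinal 4 3 isT))).
  by move=> x; apply: eq_quat; rewrite /= mxE.
move=> v; apply/rowP; case=> [[|[|[|[|//]]]] ?];
  by rewrite !mxE /=; congr (v _ _); apply: val_inj.
Qed.
HB.instance Definition _ := Lmodule_hasFinDim.Build K H quat_vect.
HB.instance Definition _ := Algebra_isFalgebra.Build K H.

Lemma quat_relations (i := Quat 0 1 0 0 : H) (j := Quat 0 0 1 0 : H)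
    (k := Quat 0 0 0 1 : H) :
  [/\ i ^+ 2 = a%:A, j ^+ 2 = b%:A, i * j = k & j * i = - k].
Proof. by split; apply: eq_quat; rewrite /=; ring. Qed.

Lemma quat_basis (x : H) :
  x = quat1 x *: 1 + quati x *: Quat 0 1 0 0 + quatj x *: Quat 0 0 1 0
    + quatk x *: Quat 0 0 0 1.
Proof. by apply: eq_quat; rewrite /=; ring. Qed.

End QuaternionAlgebra.

Definition division_algebra (K : fieldType) (A : falgType K) :=
  forall x : A, x != 0 -> x \is a GRing.unit.

Definition legendre (m : int) (p : nat) : int :=
  if (p %| m)%Z then 0
  else if [exists x : 'I_p, ((x : nat)%:Z ^+ 2 == m %[mod p])%Z] then 1
  else -1.

Definition squarefree (d : int) :=
  forall n : int, (n ^+ 2 %| d)%Z -> n \is a GRing.unit.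

(* Discriminant of Q(sqrt d), for d squarefree and d != 1. *)
Definition quadratic_disc (d : int) : int :=
  if (d == 1 %[mod 4])%Z then d else 4 * d.

Definition generated_by_sqrt (d : int) (F : fieldExtType rat) :=
  exists2 s : F, s ^+ 2 = d%:~R & <<1; s>>%VS = fullv.

Definition imaginary_quadratic (F : fieldExtType rat) :=
  \dim {:F} = 2%N /\
  forall f : {rmorphism F -> algC}, exists x, f x \isn't Num.real.

Section NumberRings.
(* Subsets of K are Prop-valued, and ideals of the ring of integers of K are
   represented by their sets of elements in K. *)
Variable K : fieldType.
Implicit Types I J P : set K.

Definition integers : set K := [set x | integralOver (intr : int -> K) x].

Definition is_submodule I :=
  [/\ I 0, forall x y, I x -> I y -> I (x + y)
    & forall c x, integers c -> I x -> I (c * x)].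

Definition is_ideal I := I `<=` integers /\ is_submodule I.

Definition is_prime_ideal P :=
  [/\ is_ideal P, ~ P 1
    & forall x y, integers x -> integers y -> P (x * y) -> P x \/ P y].

Definition ideal_span (A : set K) : set K := smallest is_ideal A.

Definition ideal_mul I J := ideal_span [set x * y | x in I & y in J].

Definition ideal_exp I (n : nat) := iter n (ideal_mul I) integers.

Definition is_fractional_ideal I :=
  [/\ is_submodule I, I <> [set 0]
    & exists c, [/\ integers c, c != 0 & forall x, I x -> integers (c * x)]].

(* The coset of I modulo the group of principal fractional ideals. *)
Definition ideal_class I : set (set K) :=
  [set J | exists2 c, c != 0 & J = [set c * x | x in I]].

Definition class_group : set (set (set K)) :=
  [set ideal_class I | I in is_fractional_ideal].

Definition has_class_number (h : nat) := (class_group #= `I_h)%card.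

End NumberRings.

Section HilbertClassField.
Variable F : fieldType.

(* P is a prime of L; e is the exponent of P in the factorization of
   (P cap F) O_L. *)
Definition has_ramification_index (L : fieldExtType F) (P : set L) (e : nat) :=
  let pL := ideal_span [set x%:A | x in [set x : F | integers x /\ P x%:A]] in
  pL `<=` ideal_exp P e /\ ~ pL `<=` ideal_exp P e.+1.

(* Separability of the residue field extensions is automatic for number
   fields, as the residue fields are finite. *)
Definition unramified_finite (L : fieldExtType F) :=
  forall P : set L, is_prime_ideal P -> P <> [set 0] ->
    has_ramification_index P 1.

Definition unramified_infinite (L : fieldExtType F) :=
  forall f : {rmorphism L -> algC},
    (forall x : F, f x%:A \is Num.real) -> forall y, f y \is Num.real.

Definition unramified_abelian (L : splittingFieldType F) :=
  [/\ galois 1%AS {:L}%AS, abelian 'Gal({:L}%AS / 1%AS),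
      unramified_finite L & unramified_infinite L].

(* The maximal unramified abelian extension of F, which is determined up to
   F-isomorphism. *)
Definition hilbert_class_field (L : splittingFieldType F) :=
  unramified_abelian L /\
  forall M : splittingFieldType F, unramified_abelian M ->
    inhabited 'AHom(M, L).

End HilbertClassField.

(* Main.v *)
(* The class number enters only through genus theory: it is odd and greater than
   1, so d = -q with q a prime congruent to 3 modulo 4. Indeed, for an odd prime
   r | d with d <> -r, or for r = 2 when d = 3 mod 4, the prime above r is not
   principal and its square is, so that multiplication by it is an involution of
   the class group without fixed points; and d = -1, -2 have class number 1.

   If [L : F] were even, L would contain a square root of some non-square x in F.
   As L / F is unramified, all valuations of x are even, hence N x is a square in
   Q and, by Hilbert 90, x is a rational number t times a square. Only q may have
   an odd valuation in t, so t is 1 or -1 times a square of F, and F(i) / F is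
   ramified at 2. Thus [L : F] is odd and no class field theory is needed.

   H_K(p, 2) splits if and only if p is a norm a^2 - 2b^2 from K(sqrt 2). Taking
   norms in the odd degree extension L / F, it holds over F as soon as it holds
   over L. If p or 2 splits in F, replacing sqrt d by an integer modulo a large
   power of that prime gives a contradiction. Otherwise q = 3 mod 8 and either
   p = q, where p = -(sqrt d)^2 and -1 = 1 - 2, or Legendre's theorem yields a
   rational solution of p = 2x^2 + qy^2, where q = -(sqrt d)^2. *)
From HB Require Import structures.
From mathcomp Require Import all_boot all_order all_fingroup all_algebra.
From mathcomp Require Import all_solvable all_field.
From mathcomp Require Import ring lra zify.
From mathcomp Require Import boolp classical_sets functions cardinality.
Require Import Defs.

Set Implicit Arguments.
Unset Strict Implicit.
Unset Printing Implicit Defensive.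

Import Order.TTheory GRing.Theory Num.Theory.

(** Ideals of L are never factored. Working locally at a maximal ideal P means multiplying by
    elements outside P: [c * x = r * z] with c outside P says that r divides x locally. To
    contradict that P is unramified, it then suffices to find one element of P whose square
    generates P cap F up to such multipliers. Parities of valuations are carried to F by norms,
    where they are exponents of primes in rational integers. Completions are avoided likewise: a
    p-adic or 2-adic point becomes a congruence modulo every power of the prime, and descent makes a
    common denominator divisible by all these powers. The theorem on ternary forms serves three
    times: for the rational point when neither p nor 2 splits and, read backwards, for the two facts
    on quadratic residues behind its hypotheses, as the zero that it would give is impossible modulo
    8 or 4. *)

Lemma abelian_index2 (gT : finGroupType) (G : {group gT}) : abelian G ->
  ~~ odd #|G| -> exists2 H : {group gT}, (H \subset G)%g & #|G : H|%g = 2%N.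
Proof.
(* G / K is a nontrivial abelian 2-group. It has a subgroup of prime index, and that prime divides a
   power of 2. *)
move=> cG evG; pose K := [group of 'O_2^'(G)%g].
have nKG : (K <| G)%g by apply: pcore_normal.
have hallK : (2^'.-Hall(G) K)%g by apply/nilpotent_pcore_Hall/abelian_nil.
have dvd2 : (2 %| #|G|)%N by rewrite dvdn2.
have cGK : abelian (G / K)%g by apply: quotient_abelian.
have oGK : (#|G / K|)%g = (#|G| `_2)%N.
  rewrite card_quotient ?normal_norm // -divgS ?normal_sub // (card_Hall hallK).
  by rewrite -{1}(partnC 2 (cardG_gt0 G)) mulnK.
have ntGK : (G / K)%g != 1%g.
  rewrite -cardG_gt1 oGK p_part -(expn0 2) ltn_exp2l //.
  by rewrite logn_gt0 mem_primes /= cardG_gt0.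
have [Hb nHb prHb] := sol_prime_factor_exists (abelian_sol cGK) ntGK.
have [H HbE sKH sHG] := inv_quotientS nKG (normal_sub nHb).
exists H => //.
have idx : (#|G / K : H / K|)%g = (#|G : H|)%g.
  apply: index_quotient_eq => //; last exact: normal_norm.
  exact: fintype.subset_trans (subsetIr _ _) sKH.
move: prHb; rewrite HbE idx => prH.
have : (#|G : H| %| #|G| `_2)%g by rewrite -idx -oGK dvdn_indexg.
by rewrite p_part Euclid_dvdX // => /andP []; rewrite dvdn_prime2 // => /eqP.
Qed.

Local Open Scope ring_scope.

(** * Ternary quadratic forms and quadratic residues *)

(** Two points of the box with sides X, Y, Z give the same residues to the three linear forms modulo
    a, b, c; their difference is the short vector. *)
Lemma lin_pigeonhole (a b c X Y Z : nat) (s t u : int) :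
  (0 < a)%N -> (0 < b)%N -> (0 < c)%N -> (a * b * c < X * Y * Z)%N ->
  exists x y z : int, [/\ [|| x != 0, y != 0 | z != 0],
    [/\ `|x| < X%:Z, `|y| < Y%:Z & `|z| < Z%:Z] &
    [/\ (a %| y - s * z)%Z, (b %| x - t * z)%Z & (c %| x - u * y)%Z]].
Proof.
move=> a0 b0 c0 lt_abc.
pose res (m : nat) (m0 : (0 < m)%N) (n : int) : 'I_m :=
  Ordinal (ltn_pmod `|(n %% m)%Z|%N m0).
have res_eq m (m0 : (0 < m)%N) n n' :
    res m m0 n = res m m0 n' -> (m %| n - n')%Z.
  move=> /(congr1 val) /= h; rewrite -eqz_mod_dvd; apply/eqP.
  have ge0 k : (0 <= k %% m)%Z by apply: modz_ge0; lia.
  have ltm k : (k %% m < m)%Z by apply: ltz_pmod; lia.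
  have := ge0 n; have := ge0 n'; have := ltm n; have := ltm n'.
  by move: h; rewrite !modn_small; lia.
pose f (v : 'I_X * 'I_Y * 'I_Z) : 'I_a * 'I_b * 'I_c :=
  let: (x, y, z) := v in
  (res a a0 (y%:Z - s * z%:Z), res b b0 (x%:Z - t * z%:Z),
   res c c0 (x%:Z - u * y%:Z)).
have : ~~ injectiveb f.
  apply/negP => /injectiveP /leq_card.
  by rewrite !card_prod !card_ord leqNgt lt_abc.
move=> /injectivePn [[[x y] z]] [[[x' y'] z']] neq h.
have /res_eq hA := congr1 (fun v => v.1.1) h.
have /res_eq hB := congr1 (fun v => v.1.2) h.
have /res_eq hC := congr1 (fun v => v.2) h.
exists (x%:Z - x'%:Z), (y%:Z - y'%:Z), (z%:Z - z'%:Z); split.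
- apply/negPn/negP => /norP [/negPn/eqP hx /norP [/negPn/eqP hy /negPn/eqP hz]].
  case/negP: neq; rewrite !xpair_eqE -!val_eqE /=; lia.
- by case: x x' y y' z z' {neq h hA hB hC} => [x ?] [x' ?] [y ?] [y' ?] [z ?] [z' ?] /=;
    split; lia.
- split; [move: hA | move: hB | move: hC]; congr (_ %| _)%Z; ring.
Qed.

(** With m as the side of the box, the volume exceeds the number of residues, while the strict bound
    |x| < m still gives x^2 <= n. *)
Lemma ceil_sqrt (n : nat) : (0 < n)%N ->
  exists2 m : nat, (n < m ^ 2)%N & (m.-1 ^ 2 <= n)%N.
Proof.
move=> n0; have ex : exists m : nat, (n < m ^ 2)%N by exists n.+1; nia.
exists (ex_minn ex); case: ex_minnP => // m lt_m min_m.
by rewrite leqNgt; apply/negP => /min_m; case: (m) lt_m; lia.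
Qed.

(* Legendre's theorem on ternary forms, by the pigeonhole principle: the three
   congruences define a lattice of index abc on which ax^2 + by^2 - cz^2 is a
   multiple of abc; a short vector gives 0 or abc, and the latter value is
   turned into a zero by the identity
   a (xz + by)^2 + b (yz - ax)^2 = c (z^2 + ab)^2. *)
Lemma legendre_ternary (a b c : nat) (s t u : int) :
  (0 < a)%N -> (0 < b)%N -> (0 < c)%N ->
  coprime a b -> coprime a c -> coprime b c ->
  (forall z : int, z ^+ 2 != a%:Z * b%:Z) ->
  (forall z : int, z ^+ 2 != b%:Z * c%:Z) ->
  (a %| b%:Z * s ^+ 2 - c%:Z)%Z ->
  (b %| a%:Z * t ^+ 2 - c%:Z)%Z ->
  (c %| a%:Z * u ^+ 2 + b%:Z)%Z ->
  exists x y z : int, z != 0 /\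
    a%:Z * x ^+ 2 + b%:Z * y ^+ 2 = c%:Z * z ^+ 2.
Proof.
move=> a0 b0 c0 cab cac cbc nab nbc ha hb hc.
have [X ltX leX] := @ceil_sqrt (b * c) ltac:(by rewrite muln_gt0 b0).
have [Y ltY leY] := @ceil_sqrt (a * c) ltac:(by rewrite muln_gt0 a0).
have [Z ltZ leZ] := @ceil_sqrt (a * b) ltac:(by rewrite muln_gt0 a0).
have lt_abc : (a * b * c < X * Y * Z)%N.
  rewrite -ltn_sqr !expnMn.
  have -> : (a ^ 2 * b ^ 2 * c ^ 2 = (b * c) * (a * c) * (a * b))%N by ring.
  by apply: ltn_mul => //; apply: ltn_mul.
have [x [y [z [nz [bx by_ bz] [da db dc]]]]] :=
  lin_pigeonhole s t u a0 b0 c0 lt_abc.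
have sq_le (w : int) (W n : nat) : `|w| < W%:Z -> (W.-1 ^ 2 <= n)%N -> w ^+ 2 <= n%:Z.
  move=> hw hW; rewrite -(gez0_abs (sqr_ge0 w)) lez_nat abszX.
  by apply: leq_trans hW; rewrite leq_sqr; move: hw; clear; lia.
have {}bx := sq_le _ _ _ bx leX; have {}by_ := sq_le _ _ _ by_ leY.
have {}bz := sq_le _ _ _ bz leZ.
have comb (m p q v w i0 j0 : int) : (m %| p)%Z -> (m %| q)%Z ->
    (m %| m * i0 + v * p * j0 + q * w)%Z.
  move=> /dvdzP [i ->] /dvdzP [j ->]; apply/dvdzP.
  by exists (i0 + v * i * j0 + j * w); ring.
have [k hk] : exists k : int,
    a%:Z * x ^+ 2 + b%:Z * y ^+ 2 - c%:Z * z ^+ 2 = k * (a * b * c)%N%:Z.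
  apply/dvdzP.
  rewrite !PoszM Gauss_dvdz ?Gauss_dvdz -?PoszM ?coprimezE //=; last first.
  - by rewrite coprimeMl cac.
  apply/andP; split; [apply/andP; split|].
  - have -> : a%:Z * x ^+ 2 + b%:Z * y ^+ 2 - c%:Z * z ^+ 2 =
      a%:Z * x ^+ 2 + b%:Z * (y - s * z) * (y + s * z) +
      (b%:Z * s ^+ 2 - c%:Z) * z ^+ 2 by ring.
    exact: comb.
  - have -> : a%:Z * x ^+ 2 + b%:Z * y ^+ 2 - c%:Z * z ^+ 2 =
      b%:Z * y ^+ 2 + a%:Z * (x - t * z) * (x + t * z) +
      (a%:Z * t ^+ 2 - c%:Z) * z ^+ 2 by ring.
    exact: comb.
  - have -> : a%:Z * x ^+ 2 + b%:Z * y ^+ 2 - c%:Z * z ^+ 2 =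
      c%:Z * (- z ^+ 2) + a%:Z * (x - u * y) * (x + u * y) +
      (a%:Z * u ^+ 2 + b%:Z) * y ^+ 2 by ring.
    exact: comb.
have x2 := sqr_ge0 x; have y2 := sqr_ge0 y; have z2 := sqr_ge0 z.
have A0 : 0 < a%:Z by []. have B0 : 0 < b%:Z by []. have C0 : 0 < c%:Z by [].
have [N hN] : exists N : int, N = a%:Z * b%:Z * c%:Z by eexists.
have N0 : 0 < N by rewrite hN !mulr_gt0.
have hk' : a%:Z * x ^+ 2 + b%:Z * y ^+ 2 - c%:Z * z ^+ 2 = k * N by rewrite hk hN !PoszM.
have ax : a%:Z * x ^+ 2 <= N.
  by rewrite hN -mulrA ler_wpM2l // ?PoszM // -?PoszM ?(le_trans bx).
have by' : b%:Z * y ^+ 2 <= N.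
  by rewrite hN [a%:Z * _]mulrC -mulrA ler_wpM2l // -?PoszM ?(le_trans by_).
have cz : c%:Z * z ^+ 2 <= N.
  by rewrite hN [_ * c%:Z]mulrC ler_wpM2l // -?PoszM ?(le_trans bz).
have nbx : x ^+ 2 <> b%:Z * c%:Z by move=> h; have := nbc x; rewrite h eqxx.
have nbz : z ^+ 2 <> a%:Z * b%:Z by move=> h; have := nab z; rewrite h eqxx.
have cz' : c%:Z * z ^+ 2 < N.
  rewrite lt_neqAle cz andbT; apply/eqP; rewrite hN => h; apply: nbz.
  by apply: (mulfI (lt0r_neq0 C0)); rewrite h; ring.
have ax' : a%:Z * x ^+ 2 < N.
  rewrite lt_neqAle ax andbT; apply/eqP; rewrite hN => h; apply: nbx.
  by apply: (mulfI (lt0r_neq0 A0)); rewrite h; ring.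
have axn : 0 <= a%:Z * x ^+ 2 by rewrite mulr_ge0.
have byn : 0 <= b%:Z * y ^+ 2 by rewrite mulr_ge0.
have czn : 0 <= c%:Z * z ^+ 2 by rewrite mulr_ge0.
(* The value k N lies strictly between -N and 2N; strictness comes from ab and bc not being
   squares. *)
have kN : k = 0 \/ k = 1.
  have : - 1 * N < k * N.
    by rewrite -hk'; move: axn byn cz'; clear; lia.
  have : k * N < 2 * N.
    by rewrite -hk'; move: czn ax' by'; clear; lia.
  by rewrite !ltr_pM2r //; clear; lia.
case: kN => kE.
- exists x, y, z; split; last by move: hk'; rewrite kE; clear; lia.
  apply/eqP => z0; move: hk'; rewrite kE z0 mul0r expr0n /= mulr0 subr0.
  move=> h; have h1 : a%:Z * x ^+ 2 = 0 by move: h axn byn; clear; lia.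
  have h2 : b%:Z * y ^+ 2 = 0 by move: h axn byn; clear; lia.
  move/eqP: h1; rewrite mulf_eq0 sqrf_eq0 (gt_eqF A0) /= => /eqP h1.
  move/eqP: h2; rewrite mulf_eq0 sqrf_eq0 (gt_eqF B0) /= => /eqP h2.
  by move: nz; rewrite h1 h2 z0 eqxx.
- exists (x * z + b%:Z * y), (y * z - a%:Z * x), (z ^+ 2 + a%:Z * b%:Z).
  split; first by move: (mulr_gt0 A0 B0) z2; clear; lia.
  have h : a%:Z * x ^+ 2 + b%:Z * y ^+ 2 = c%:Z * z ^+ 2 + a%:Z * b%:Z * c%:Z.
    by move: hk'; rewrite kE hN mul1r => <-; ring.
  have -> : a%:Z * (x * z + b%:Z * y) ^+ 2 + b%:Z * (y * z - a%:Z * x) ^+ 2 =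
    (a%:Z * x ^+ 2 + b%:Z * y ^+ 2) * (z ^+ 2 + a%:Z * b%:Z) by ring.
  by rewrite h; ring.
Qed.

(** This also holds when p divides m, so its negation says that m is a genuine non-residue. *)
Definition sqmod (m : int) (p : nat) := exists x : int, (p %| x ^+ 2 - m)%Z.

(** Makes congruences modulo 4 and 8 between squares accessible to linear arithmetic. *)
Lemma even_or_sqr8 (x : int) :
  (exists j, x = 2 * j) \/ (exists k, x ^+ 2 = 8 * k + 1).
Proof.
have [/dvdzP [j ->]|nx] := boolP (2 %| x)%Z; first by left; exists j; rewrite mulrC.
right; have [k ->] : exists k, x = 2 * k + 1.
  by exists ((x - 1) %/ 2)%Z; lia.
have [[i ->]|[i ->]] : (exists i, k = 2 * i) \/ (exists i, k = 2 * i + 1).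
- have [h|h] := boolP (2 %| k)%Z;
    [left; exists (k %/ 2)%Z | right; exists ((k - 1) %/ 2)%Z]; lia.
- by exists (2 * i ^+ 2 + i); ring.
- by exists (2 * i ^+ 2 + 3 * i + 1); ring.
Qed.

Lemma prime_dvdzM (p : nat) (m n : int) : prime p ->
  (p %| m * n)%Z = (p %| m)%Z || (p %| n)%Z.
Proof. by move=> hp; rewrite !dvdzE abszM Euclid_dvdM. Qed.

Lemma prime_dvdzX (p : nat) (m : int) : prime p ->
  (p %| m ^+ 2)%Z = (p %| m)%Z.
Proof. by move=> hp; rewrite expr2 prime_dvdzM // orbb. Qed.

Lemma dvdz_prime_sqr_neq (p : nat) (m z : int) : prime p -> ~~ (p %| m)%Z ->
  z ^+ 2 != p%:Z * m.
Proof.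
move=> hp nm; apply/eqP => h.
have /dvdzP [y zE] : (p %| z)%Z by rewrite -prime_dvdzX // h dvdz_mulr.
case/negP: nm; apply/dvdzP; exists (y ^+ 2).
have p0 : p%:Z != 0 by case: (p) hp.
by apply: (mulfI p0); rewrite -h zE; ring.
Qed.

Lemma inverse_modz (p : nat) (m : int) : prime p -> ~~ (p %| m)%Z ->
  exists n, (p %| m * n - 1)%Z.
Proof.
move=> hp nm.
have : coprimez p m by rewrite coprimezE /= prime_coprime.
case/coprimezP => -[u v] /= uv; exists v; apply/dvdzP; exists (- u).
by rewrite -uv; ring.
Qed.

(* Otherwise x^2 + py^2 = 2z^2 would be solvable, but it is not modulo 8. *)
Lemma two_nonres (p : nat) : prime p -> p = 3 %[mod 8] -> ~ sqmod 2 p.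
Proof.
move=> hp hp8 [t ht].
have [m pE] : exists m : int, p%:Z = 8 * m + 3.
  by exists (p %/ 8)%N%:Z; move: hp8; lia.
have nd (n : int) : 0 < n < 3 -> ~~ (p %| n)%Z.
  move=> hn; rewrite dvdzE /= gtnNdvd //; first by lia.
  by have := prime_gt1 hp; lia.
have cp2 : coprime p 2.
  by rewrite coprime_sym prime_coprime //; move: hp8; clear; lia.
have [x [y [z [z0 E]]]] := @legendre_ternary 1 p 2 0 t 1 isT (prime_gt0 hp) isT
  (coprime1n _) isT cp2
  ltac:(by move=> z; rewrite mul1r -[p%:Z]mulr1 dvdz_prime_sqr_neq ?nd)
  ltac:(by move=> z; rewrite dvdz_prime_sqr_neq ?nd)
  ltac:(by rewrite dvd1z) ltac:(by rewrite mul1r)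
  ltac:(by rewrite pE; move: {+}m; clear; lia).
move: E; rewrite mul1r pE.
(* Infinite descent on |z|: modulo 8 the three coordinates are even, and they can be halved. *)
have [n] := ubnP `|z|%N; elim: n => // n IH in x y z z0 * => lt_n E.
have [[x' xE]|[k xE]] := even_or_sqr8 x; have [[y' yE]|[k' yE]] := even_or_sqr8 y.
- have [[z' zE]|[k'' zE]] := even_or_sqr8 z; last first.
    by move: E; rewrite zE xE yE; clear; lia.
  apply: (IH x' y' z'); [by move: z0; rewrite zE; clear; lia| |].
    by move: z0 lt_n; rewrite zE; clear; lia.
  by move: E; rewrite xE yE zE; clear; lia.
- by move: E; rewrite xE yE; clear; lia.
- by move: E; rewrite xE yE; clear; lia.
- move: E; rewrite xE yE.
  by have [[z' ->]|[k'' ->]] := even_or_sqr8 z; clear; lia.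
Qed.

(* Otherwise px^2 + qy^2 = z^2 would be solvable, but it is not modulo 4. *)
Lemma reciprocity33 (p q : nat) : prime p -> prime q -> p != q ->
  p = 3 %[mod 4] -> q = 3 %[mod 4] -> sqmod q p -> ~ sqmod p q.
Proof.
move=> hp hq npq hp4 hq4 [s0 hs] [t0 ht].
have [m pE] : exists m : int, p%:Z = 4 * m + 3.
  by exists (p %/ 4)%N%:Z; move: hp4; clear; lia.
have [m' qE] : exists m : int, q%:Z = 4 * m + 3.
  by exists (q %/ 4)%N%:Z; move: hq4; clear; lia.
have cpq : coprime p q by rewrite prime_coprime // dvdn_prime2.
have npq' : ~~ (p %| q%:Z)%Z by rewrite dvdzE /= dvdn_prime2.
have nqp' : ~~ (q %| p%:Z)%Z by rewrite dvdzE /= dvdn_prime2 // eq_sym.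
(* With c = 1 the conditions read q s^2 = 1 mod p and p t^2 = 1 mod q; inverses of the given square
   roots satisfy them. *)
have inv (r : nat) (w n : int) : prime r -> ~~ (r %| n)%Z -> (r %| w ^+ 2 - n)%Z ->
    exists v, (r %| n * v ^+ 2 - 1)%Z.
  move=> hr rn hw.
  have rw : ~~ (r %| w)%Z.
    apply: contra rn => rw; have -> : n = w ^+ 2 - (w ^+ 2 - n) by ring.
    by rewrite rpredB // prime_dvdzX.
  have [v hv] := inverse_modz hr rw; exists v.
  have -> : n * v ^+ 2 - 1 = (w * v - 1) * (w * v + 1) - (w ^+ 2 - n) * v ^+ 2 by ring.
  by rewrite rpredB // dvdz_mulr.
have [s hs'] := inv _ _ _ hp npq' hs.
have [t ht'] := inv _ _ _ hq nqp' ht.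
have q1 : ~~ (q %| 1)%Z by rewrite dvdzE /= dvdn1; case: (q) hq => [|[]].
have [x [y [z [z0 E]]]] := @legendre_ternary p q 1 s t 0 (prime_gt0 hp)
  (prime_gt0 hq) isT cpq (coprimen1 _) (coprimen1 _)
  ltac:(by move=> z; rewrite dvdz_prime_sqr_neq)
  ltac:(by move=> z; rewrite dvdz_prime_sqr_neq) hs' ht' (dvd1z _).
move: E; rewrite mul1r pE qE.
have [n] := ubnP `|z|%N; elim: n => // n IH in x y z z0 * => lt_n E.
have [[x' xE]|[k xE]] := even_or_sqr8 x; have [[y' yE]|[k' yE]] := even_or_sqr8 y;
  have [[z' zE]|[k'' zE]] := even_or_sqr8 z;
  try by move: E; rewrite xE yE zE; clear; lia.
apply: (IH x' y' z'); [by move: z0; rewrite zE; clear; lia| |].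
  by move: z0 lt_n; rewrite zE; clear; lia.
by move: E; rewrite xE yE zE; clear; lia.
Qed.

Lemma sqmodP (p : nat) (m : int) : prime p ->
  sqmod m p <-> exists x : 'F_p, x ^+ 2 = m%:~R.
Proof.
move=> hp; have ch : p \in [pchar 'F_p] by apply: pchar_Fp.
have dvd (n : int) : (p %| n)%Z <-> n%:~R = 0 :> 'F_p.
  by split => [|/eqP]; rewrite ?(dvdz_pcharf ch) => // /eqP.
split => [[x /dvd]|[x hx]].
  by rewrite rmorphB rmorphXn /= => /eqP; rewrite subr_eq0 => /eqP <-; exists x%:~R.
exists (x : nat); apply/dvd; rewrite rmorphB rmorphXn /= -hx.
by apply/eqP; rewrite subr_eq0 -pmulrn natr_Zp.
Qed.

(** If x^2 = -1 in the field with p = 4m + 3 elements, then x = x^p = (x^2)^(2m) x^3 = -x, whence x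
    = 0. *)
Lemma minus_one_nonres (p : nat) : prime p -> p = 3 %[mod 4] -> ~ sqmod (-1) p.
Proof.
move=> hp hp4 /(sqmodP _ hp) [x hx].
have xp : x ^+ p = x by have := expf_card x; rewrite card_Fp.
have pE : p = (2 * (2 * (p %/ 4)) + 3)%N by move: hp4; clear; lia.
have : x ^+ p = - x.
  have -> : x ^+ p = x ^+ (2 * (2 * (p %/ 4)) + 3) by congr (_ ^+ _).
  by rewrite exprD exprM hx rmorphN1 exprM sqrrN !expr1n mul1r exprS hx rmorphN1
    mulrN1.
rewrite xp => /eqP; rewrite -subr_eq0 opprK -mulr2n -mulr_natl mulf_eq0.
have -> : (2%:R == 0 :> 'F_p) = false.
  rewrite -(dvdn_pcharf (pchar_Fp hp)) gtnNdvd //.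
  by move: hp4 (prime_gt1 hp); clear; lia.
move=> /eqP x0; move/eqP: hx; rewrite x0 expr0n rmorphN1 eq_sym oppr_eq0.
by rewrite oner_eq0.
Qed.

(** Non-residues are the odd powers of a generator of the cyclic unit group, and a sum of two odd
    exponents is even. *)
Lemma nonres_mul (p : nat) (m n : int) : prime p ->
  ~ sqmod m p -> ~ sqmod n p -> sqmod (m * n) p.
Proof.
move=> hp hm hn; apply/sqmodP => //.
have [g genU] := cyclicP (field_unit_group_cyclic [group of [set: {unit 'F_p}]]).
have rep k : ~ sqmod k p -> exists i, k%:~R = val g ^+ i.*2.+1 :> 'F_p.
  move=> hk; have k0 : k%:~R != 0 :> 'F_p.
    by apply/eqP => k0; apply: hk; apply/sqmodP => //; exists 0; rewrite expr0n k0.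
  have ku : (k%:~R : 'F_p) \is a GRing.unit by rewrite unitfE.
  have : FinRing.unit 'F_p ku \in <[g]>%g by rewrite -genU inE.
  case/cycleP => i /(congr1 val); rewrite /= FinRing.val_unitX => kE.
  exists i./2; rewrite kE; congr (_ ^+ _).
  rewrite -[LHS]odd_double_half; case: (boolP (odd i)) => // ev; exfalso; apply: hk.
  apply/sqmodP => //; exists (val g ^+ i./2).
  rewrite kE -[in RHS](odd_double_half i) (negbTE ev) add0n -muln2.
  by rewrite exprM.
have [i mE] := rep _ hm; have [j nE] := rep _ hn.
exists (val g ^+ (i + j).+1); rewrite rmorphM /= mE nE -exprM -exprD.
by congr (_ ^+ _); clear; lia.
Qed.

(* Legendre's conditions: -2q is a square mod p, as a product of non-residues,
   and so is 2p mod q, by reciprocity. *)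
Lemma ternary_2qp (p q : nat) : prime p -> prime q -> p != q ->
  p = 3 %[mod 8] -> q = 3 %[mod 8] -> ~ sqmod (- q%:Z) p ->
  exists x y z : int, z != 0 /\
    2 * x ^+ 2 + q%:Z * y ^+ 2 = p%:Z * z ^+ 2.
Proof.
move=> hp hq npq hp8 hq8 nr.
have hp4 : p = 3 %[mod 4] by move: hp8; clear; lia.
have hq4 : q = 3 %[mod 4] by move: hq8; clear; lia.
have cpq : coprime p q by rewrite prime_coprime // dvdn_prime2.
have qp : sqmod q p.
  by have := nonres_mul hp nr (minus_one_nonres hp hp4); rewrite mulrN1 opprK.
have pq : ~ sqmod p q by apply: reciprocity33 qp.
have [w hw] := nonres_mul hq (two_nonres hq hq8) pq.
have [v hv] := nonres_mul hp (two_nonres hp hp8) nr.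
have half (r : nat) (k n : int) : r = 3 %[mod 8] -> (r %| k ^+ 2 - 2 * n)%Z ->
    exists t, (r %| 2 * t ^+ 2 - n)%Z.
  move=> hr hk; have [m rE] : exists m : int, r%:Z = 2 * m + 1.
    by exists (r %/ 2)%N%:Z; move: hr; clear; lia.
  (* m + 1 is the inverse of 2 modulo r = 2m + 1, so this is k / 2. *)
  exists (k * (m + 1)).
  have -> : 2 * (k * (m + 1)) ^+ 2 - n =
    (k ^+ 2 - 2 * n) * (2 * (m + 1) ^+ 2) + (2 * m + 1) * (n * (2 * m + 3)) by ring.
  by rewrite -rE rpredD // dvdz_mulr.
have [t ht] := half _ _ _ hq8 hw.
have [u hu] := half _ _ _ hp8 hv.
have q2 : ~~ (q %| 2)%Z.
  by rewrite dvdzE /= gtnNdvd //; move: hq8 (prime_gt1 hq); clear; lia.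
have cop2 (r : nat) : r = 3 %[mod 8] -> coprime 2 r.
  by move=> hr; rewrite prime_coprime //; move: hr; clear; lia.
apply: (@legendre_ternary 2 q p 1 t u) => //; try exact: prime_gt0; try exact: cop2.
- by rewrite coprime_sym.
- by move=> z; rewrite mulrC dvdz_prime_sqr_neq.
- by move=> z; rewrite dvdz_prime_sqr_neq // dvdzE /= dvdn_prime2 // eq_sym.
- by move: hp8 hq8; clear; lia.
- by move: hu; rewrite opprK.
Qed.

(** * Square roots modulo prime powers and the local obstruction *)

Lemma hensel_sqrt_odd (p : nat) (d : int) (k : nat) :
  prime p -> odd p -> ~~ (p %| d)%Z -> sqmod d p ->
  exists e : int, (p%:Z ^+ k %| e ^+ 2 - d)%Z.
Proof.
move=> hp po pd [e0 he0].
suff [e [_ he]] : exists e : int,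
    (p %| e ^+ 2 - d)%Z /\ (p%:Z ^+ k %| e ^+ 2 - d)%Z by exists e.
elim: k => [|k [e [he hk]]]; first by exists e0; rewrite expr0 dvd1z.
case: k hk => [|k] hk; first by exists e; rewrite expr1.
have pe : ~~ (p %| 2 * e)%Z.
  rewrite prime_dvdzM // negb_or; apply/andP; split.
    rewrite dvdzE /= dvdn_prime2 //; apply: contraTneq po => ->; by [].
  apply: contra pd => h; have -> : d = e ^+ 2 - (e ^+ 2 - d) by ring.
  by rewrite rpredB // prime_dvdzX.
have [v hv] := inverse_modz hp pe.
case/dvdzP: hk => m hm.
(* The Newton correction: v is the inverse of 2e modulo p. The congruence modulo p is kept in the
   induction so that 2e remains invertible. *)
pose t := - m * v; exists (e + p%:Z ^+ k.+1 * t).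
have E : (e + p%:Z ^+ k.+1 * t) ^+ 2 - d =
    p%:Z ^+ k.+2 * (p%:Z ^+ k * t ^+ 2) - p%:Z ^+ k.+1 * (m * (2 * e * v - 1)).
  transitivity (e ^+ 2 - d + p%:Z ^+ k.+1 * (2 * e * t) + (p%:Z ^+ k.+1 * t) ^+ 2).
    by ring.
  by rewrite hm /t !exprS; ring.
have main : (p%:Z ^+ k.+2 %| (e + p%:Z ^+ k.+1 * t) ^+ 2 - d)%Z.
  rewrite E rpredB //; first exact: dvdz_mulr.
  rewrite [p%:Z ^+ k.+2]exprSr.
  by apply: dvdz_mul => //; apply: dvdz_mull.
by split => //; apply: dvdz_trans main; rewrite exprS dvdz_mulr.
Qed.

(** The lifting starts at modulus 8, with root 1. If e^2 - d = 2^(k+3) m, adding 2^(k+2) m to e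
    contributes 2^(k+3) e m, and m + e m is even because e is odd. *)
Lemma hensel_sqrt_two (d : int) (k : nat) : (d = 1 %[mod 8])%Z ->
  exists e : int, (2 ^+ k %| e ^+ 2 - d)%Z.
Proof.
move=> hd; suff [e [_ he]] : exists e : int,
    ~~ (2 %| e)%Z /\ (2 ^+ k.+3 %| e ^+ 2 - d)%Z.
  exists e; apply: dvdz_trans he.
  by rewrite dvdz_exp2l // -[k in (k <= _)%N]addn0 -addn3 leq_add2l.
elim: k => [|k [e [oe hk]]].
  by exists 1; split => //; move: hd; clear; lia.
case/dvdzP: hk => m hm.
have [j oj] : exists j, e = 2 * j + 1 by exists ((e - 1) %/ 2)%Z; move: oe; clear; lia.
exists (e + 2 ^+ k.+2 * m); split.
  by rewrite exprS; move: oe; clear; lia.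
have -> : (e + 2 ^+ k.+2 * m) ^+ 2 - d =
    2 ^+ k.+4 * ((j + 1) * m + 2 ^+ k * m ^+ 2).
  transitivity (e ^+ 2 - d + 2 ^+ k.+2 * (2 * e * m) + (2 ^+ k.+2 * m) ^+ 2).
    by ring.
  by rewrite hm oj !exprS; ring.
exact: dvdz_mulr.
Qed.

(** As 2 is a non-residue, p | A^2 - 2B^2 forces p to divide A and B, and then c; all three are
    divided by p and the modulus loses p^2. *)
Lemma norm2_descent_p (p : nat) (j : nat) (A B c : int) :
  prime p -> p = 3 %[mod 8] ->
  (p%:Z ^+ j.*2 %| A ^+ 2 - 2 * B ^+ 2 - p%:Z * c ^+ 2)%Z -> (p%:Z ^+ j %| c)%Z.
Proof.
move=> hp hp8; have p0 : p%:Z != 0 by case: (p) hp.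
elim: j A B c => [|j IH] A B c; first by rewrite expr0 dvd1z.
rewrite doubleS (exprS _ j.*2.+1) (exprS _ j.*2) => h.
have h1 : (p %| A ^+ 2 - 2 * B ^+ 2)%Z.
  have -> : A ^+ 2 - 2 * B ^+ 2 =
    A ^+ 2 - 2 * B ^+ 2 - p%:Z * c ^+ 2 + p%:Z * c ^+ 2 by ring.
  by rewrite rpredD ?(dvdz_mulr _ (dvdzz _)) //; apply: dvdz_trans h; rewrite dvdz_mulr.
have pB : (p %| B)%Z.
  apply/negPn/negP => pB; have [v hv] := inverse_modz hp pB.
  apply: (two_nonres hp hp8); exists (A * v).
  have -> : (A * v) ^+ 2 - 2 =
    (A ^+ 2 - 2 * B ^+ 2) * v ^+ 2 + (B * v - 1) * (2 * (B * v + 1)) by ring.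
  by rewrite rpredD // dvdz_mulr.
have pA : (p %| A)%Z.
  rewrite -prime_dvdzX //.
  have -> : A ^+ 2 = A ^+ 2 - 2 * B ^+ 2 + B * (2 * B) by ring.
  by rewrite rpredD // dvdz_mulr.
case/dvdzP: pA h => A' ->; case/dvdzP: pB => B' -> h.
have pc : (p %| c)%Z.
  rewrite -prime_dvdzX // -(dvdz_mul2l p0).
  have -> : p%:Z * c ^+ 2 = p%:Z * p%:Z * (A' ^+ 2 - 2 * B' ^+ 2) -
    ((A' * p) ^+ 2 - 2 * (B' * p) ^+ 2 - p%:Z * c ^+ 2) by ring.
  rewrite rpredB ?(dvdz_mulr _ (dvdzz _)) //.
  by apply: dvdz_trans h; rewrite mulrA dvdz_mulr.
case/dvdzP: pc h => c' -> h.
rewrite exprSr dvdz_mul2r //; apply: (IH A' B').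
rewrite -(dvdz_mul2l p0) -(dvdz_mul2l p0).
by congr (_ %| _)%Z: h; ring.
Qed.

(** Modulo 8 the relation A^2 - 2B^2 = 3c^2 makes A, B and c even. Halving them costs a factor 4;
    the odd exponent 2j + 1 keeps the modulus at least 8 as long as a step remains. *)
Lemma norm2_descent_two (p : nat) (j : nat) (A B c : int) :
  p = 3 %[mod 8] ->
  (2 ^+ j.*2.+1 %| A ^+ 2 - 2 * B ^+ 2 - p%:Z * c ^+ 2)%Z -> (2 ^+ j %| c)%Z.
Proof.
move=> hp8; have [m pE] : exists m : int, p%:Z = 8 * m + 3.
  by exists (p %/ 8)%N%:Z; move: hp8; clear; lia.
elim: j A B c => [|j IH] A B c; first by rewrite expr0 dvd1z.
rewrite doubleS (exprS _ j.*2.+2) (exprS _ j.*2.+1) pE => h.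
have /dvdzP [n hn] : (8 %| A ^+ 2 - 2 * B ^+ 2 - (8 * m + 3) * c ^+ 2)%Z.
  by apply: dvdz_trans h; rewrite exprS !mulrA dvdz_mulr.
move: hn h.
have [[A' AE]|[k AE]] := even_or_sqr8 A; have [[B' BE]|[k' BE]] := even_or_sqr8 B;
  have [[c' cE]|[k'' cE]] := even_or_sqr8 c;
  try by rewrite AE BE cE; clear; lia.
move=> _; rewrite AE BE cE (exprS 2 j) => h.
rewrite dvdz_mul2l //; apply: (IH A' B').
rewrite -(@dvdz_mul2l 2) // -(@dvdz_mul2l 2) // pE.
by congr (_ %| _)%Z: h; rewrite exprS; ring.
Qed.

(* If p (resp. 2) splits in Q(sqrt d), then sqrt d may be replaced by an integer
   e with e^2 = d modulo a large power of that prime. *)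
Lemma no_norm2_split (p : nat) (d a1 a2 b1 b2 c : int) :
  prime p -> odd p -> p = 3 %[mod 8] ->
  (~~ (p %| d)%Z /\ sqmod d p) \/ (d = 1 %[mod 8])%Z ->
  a1 ^+ 2 + d * a2 ^+ 2 - 2 * (b1 ^+ 2 + d * b2 ^+ 2) = p%:Z * c ^+ 2 ->
  a1 * a2 = 2 * (b1 * b2) -> c = 0.
Proof.
move=> hp po hp8 hd E1 E2.
(* E1 and E2 are the two coordinates of a^2 - 2b^2 = p c^2 in the basis 1, sqrt d; putting e for
   sqrt d changes the relation by a multiple of e^2 - d. *)
have key (r : int) (k : nat) (e : int) : (r ^+ k %| e ^+ 2 - d)%Z ->
    (r ^+ k %| (a1 + a2 * e) ^+ 2 - 2 * (b1 + b2 * e) ^+ 2 - p%:Z * c ^+ 2)%Z.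
  move=> h; rewrite -E1.
  have -> : (a1 + a2 * e) ^+ 2 - 2 * (b1 + b2 * e) ^+ 2 -
    (a1 ^+ 2 + d * a2 ^+ 2 - 2 * (b1 ^+ 2 + d * b2 ^+ 2)) =
    (e ^+ 2 - d) * (a2 ^+ 2 - 2 * b2 ^+ 2) + 2 * e * (a1 * a2 - 2 * (b1 * b2)) by ring.
  by rewrite E2 subrr mulr0 addr0 dvdz_mulr.
have small (r : nat) : (1 < r)%N -> (forall j, (r%:Z ^+ j %| c)%Z) -> c = 0.
  move=> r1 h; apply/eqP; rewrite -absz_eq0; apply/negPn/negP; rewrite -lt0n => c0.
  have := h `|c|%N; rewrite dvdzE abszX /= => /(dvdn_leq c0).
  by rewrite leqNgt ltn_expl.
case: hd => [[pd sq]|d8].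
- apply: (small p (prime_gt1 hp)) => j.
  have [e he] := hensel_sqrt_odd j.*2 hp po pd sq.
  exact: norm2_descent_p (key _ _ _ he).
- apply: (small 2) => // j.
  have [e he] := hensel_sqrt_two j.*2.+1 d8.
  exact: norm2_descent_two (key _ _ _ he).
Qed.

Lemma legendre_eq1 (m : int) (p : nat) : prime p ->
  legendre m p = 1 <-> ~~ (p %| m)%Z /\ sqmod m p.
Proof.
move=> hp; rewrite /legendre; case: ifP => [pm|_]; first by split=> // -[].
split=> [|[_ [x hx]]].
  by case: existsP => // -[x hx] _; split=> //; exists x%:Z; rewrite -eqz_mod_dvd.
rewrite ifT //; apply/existsP.
have p0 : p%:Z != 0 by case: (p) hp.
have ltx : (`|(x %% p)%Z| < p)%N.
  by have := modz_ge0 x p0; have := @ltz_pmod x p; move: (prime_gt0 hp); clear; lia.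
exists (Ordinal ltx); rewrite /= gez0_abs ?modz_ge0 //.
by rewrite modzXm eqz_mod_dvd.
Qed.

(** * Algebraic integers *)

Section AlgebraicIntegers.
Variable K : fieldType.
Implicit Types x y : K.

Lemma integers_int (n : int) : integers (n%:~R : K).
Proof. exact: (integral_id (intr : {rmorphism int -> K})). Qed.

Lemma integers0 : integers (0 : K). Proof. exact: (integers_int 0). Qed.
Lemma integers1 : integers (1 : K). Proof. exact: (integers_int 1). Qed.

Lemma integersD x y : integers x -> integers y -> integers (x + y).
Proof. exact: (@integral_add _ _ (intr : {rmorphism int -> K})). Qed.

Lemma integersN x : integers x -> integers (- x).
Proof. exact: (@integral_opp _ _ (intr : {rmorphism int -> K})). Qed.

Lemma integersB x y : integers x -> integers y -> integers (x - y).
Proof. exact: (@integral_sub _ _ (intr : {rmorphism int -> K})). Qed.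

Lemma integersM x y : integers x -> integers y -> integers (x * y).
Proof. exact: (@integral_mul _ _ (intr : {rmorphism int -> K})). Qed.

Lemma integersX x n : integers x -> integers (x ^+ n).
Proof.
move=> hx; elim: n => [|n IH]; first exact: integers1.
by rewrite exprS; apply: integersM.
Qed.

Lemma integers_sqrt x : integers (x ^+ 2) -> integers x.
Proof.
move=> hx; apply: (@integral_root_monic _ _ (intr : {rmorphism int -> K}) _
  ('X^2 - (x ^+ 2)%:P)).
- exact: monicXnsubC.
- by rewrite rootE !hornerE subrr.
- apply/(integral_poly (intr : {rmorphism int -> K})) => i.
  rewrite coefB coefXn coefC.
  apply: (@integral_sub _ _ (intr : {rmorphism int -> K})); first exact: integral_nat.
  by case: ifP => // _; apply: integers0.
Qed.

End AlgebraicIntegers.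

Lemma integers_rmorph (K K' : fieldType) (f : {rmorphism K -> K'}) (x : K) :
  integers (f x) <-> integers x.
Proof.
by split=> -[p pm rp]; exists p => //; move: rp;
  rewrite -(eq_map_poly (rmorph_int f)) map_poly_comp /= fmorph_root.
Qed.

Lemma integers_rat (x : rat) : integers x -> exists n : int, x = n%:~R.
Proof.
move=> /(integers_rmorph (ratr : {rmorphism rat -> algC})) [p pm rp].
have : ratr x \in (Num.int : {pred algC}).
  apply: Cint_rat_Aint; first exact: Crat_rat.
  apply: root_monic_Aint rp _ _; first exact: monic_map.
  by apply/polyOverP => i; rewrite coef_map /= intr_int.
case/intrP => n hn; exists n; apply: (fmorph_inj (ratr : {rmorphism rat -> algC})).
by rewrite /= hn ratr_int.
Qed.

(** * Odd degree and norms *)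

(** A subgroup of index 2 would fix a quadratic extension E of F. Completing the square generates E
    by some g with g^2 in F, and such a g already lies in F. *)
Lemma odd_galois_of_no_sqrt (F : fieldType) (M : splittingFieldType F) :
  2 != 0 :> F ->
  (forall (x : F) (b : M), b ^+ 2 = x%:A -> exists c : F, c ^+ 2 = x) ->
  galois 1%AS {:M}%AS -> abelian 'Gal({:M}%AS / 1%AS) ->
  odd #|'Gal({:M}%AS / 1%AS)%g|.
Proof.
move=> two0 desc gal ab; apply/negPn/negP => /(abelian_index2 ab) [H sH iH].
have := dim_fixed_galois gal sH; rewrite iH dimv1 divn1; set E := fixedField H => dE.
have sub1E : (1 <= E)%VS by apply: sub1v.
have [be beE be1] : exists2 be, be \in E & be \notin 1%VS.
  apply: contrapT => h; have : (E <= 1)%VS.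
    apply/subvP => be beE; apply/negPn/negP => be1.
    by apply: h; exists be.
  by move=> /dimvS; rewrite dE dimv1.
have fr : free [:: be; 1].
  by rewrite free_cons span_seq1 be1 seq1_free oner_eq0.
have spE : <<[:: be; 1%R]>>%VS = E.
  apply/eqP; rewrite eqEdim dE; apply/andP; split.
    by rewrite span_cons span_seq1 subv_add -memvE beE.
  by have /eqP -> := fr.
have : be ^+ 2 \in E by rewrite expr2 rpredM.
rewrite -spE span_cons span_seq1 => /memv_addP [_ /vlineP [u ->]] [_ /vlineP [v ->]] bE.
pose g := be - (u / 2)%:A.
have gE : g ^+ 2 = (v + (u / 2) ^+ 2)%:A.
  have uE : u *: be = 2 * (u / 2)%:A * be.
    rewrite -(mulr_algl u be); congr (_ * _).
    by rewrite -!in_algE -(rmorph_nat (in_alg M) 2) -rmorphM mulrCA mulfV ?mulr1.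
  by rewrite /g sqrrB bE uE -[RHS]in_algE rmorphD rmorphXn /=; ring.
have [c cE] := desc _ _ gE.
have : (g - c%:A) * (g + c%:A) = 0.
  by rewrite -subr_sqr gE -[c%:A]/(in_alg M c) -rmorphXn cE subrr.
have alg1 (a : F) : a%:A \in (1%VS : {vspace M}) by apply/vlineP; exists a.
move=> /eqP; rewrite mulf_eq0 subr_eq0 addr_eq0 => /orP [] /eqP gc; case/negP: be1.
  by rewrite -[be](subrK (u / 2)%:A) -/g gc rpredD.
by rewrite -[be](subrK (u / 2)%:A) -/g gc rpredD // rpredN.
Qed.

(* If the reduced norm (u^2 - 2v^2) - p (w^2 - 2t^2) vanishes, then p is a
   quotient of norms from K(sqrt 2), hence such a norm. *)
Lemma division_quat (K : fieldType) (p : K) : 2 != 0 :> K ->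
  division_algebra (quat p 2) <-> ~ exists a b : K, a ^+ 2 - 2 * b ^+ 2 = p.
Proof.
move=> two0; have four0 : 4 != 0 :> K by rewrite (natrM _ 2 2) mulf_neq0.
split=> [dv [a [b E]]|np x x0].
  subst p; have x0 : Quat a 1 b 0 != 0 :> quat (a ^+ 2 - 2 * b ^+ 2) 2.
    by apply/eqP => -[_ /eqP]; rewrite oner_eq0.
  (* The element has reduced norm a^2 - p - 2b^2 = 0, so its product with its conjugate vanishes. *)
  have xy : (Quat a 1 b 0 : quat (a ^+ 2 - 2 * b ^+ 2) 2) * Quat a (- 1) (- b) 0 = 0.
    by rewrite [LHS]/(mulq _ _); apply: eq_quat; rewrite /=; ring.
  have := dv _ x0; move=> /mulrI /(_ (Quat a (- 1) (- b) 0) 0).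
  rewrite xy mulr0 => /(_ erefl) [_ /eqP].
  by rewrite oppr_eq0 oner_eq0.
have no_sqrt2 (r : K) : r ^+ 2 <> 2.
  move=> r2; have r0 : r != 0 by rewrite -sqrf_eq0 r2.
  (* If r^2 = 2 the norm form splits as (X - rY)(X + rY); these are the solutions for the factors 1
     and p. *)
  apply: np; exists ((p + 1) / 2), ((p - 1) / (2 * r)).
  have -> : ((p - 1) / (2 * r)) ^+ 2 = (p - 1) ^+ 2 / (4 * r ^+ 2).
    by field; rewrite r0 four0.
  by rewrite r2; field; rewrite two0 (natrM _ 4 2) mulf_neq0.
have aniso (u v : K) : u ^+ 2 - 2 * v ^+ 2 = 0 -> u = 0 /\ v = 0.
  move=> /eqP; rewrite subr_eq0 => /eqP uv; have [v0|v0] := eqVneq v 0.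
    by split=> //; apply/eqP; rewrite -sqrf_eq0 uv v0 expr0n mulr0.
  by case: (no_sqrt2 (u / v)); rewrite expr_div_n uv mulfK ?expf_neq0.
case: x x0 => x1 xi xj xk x0.
pose N := x1 ^+ 2 - p * xi ^+ 2 - 2 * xj ^+ 2 + 2 * p * xk ^+ 2.
have N0 : N != 0.
  apply: contraNneq x0 => N0.
  have [W0|W0] := eqVneq (xi ^+ 2 - 2 * xk ^+ 2) 0.
    have [xi0 xk0] := aniso _ _ W0.
    have [|x10 xj0] := aniso x1 xj.
      by rewrite -[RHS]N0 /N xi0 xk0; ring.
    by rewrite xi0 xk0 x10 xj0.
  case: np; set W := _ - _ in W0.
  (* These are the coordinates of (x1 + xj sqrt 2) / (xi - xk sqrt 2), whose norm is p W / W. *)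
  exists ((x1 * xi + 2 * xj * xk) / W), ((x1 * xk + xj * xi) / W).
  transitivity ((x1 ^+ 2 - 2 * xj ^+ 2) * W / W ^+ 2); first by rewrite /W; field.
  have -> : x1 ^+ 2 - 2 * xj ^+ 2 = N + p * W by rewrite /N /W; ring.
  by rewrite N0; field.
apply/unitrP; exists (Quat (x1 / N) (- xi / N) (- xj / N) (- xk / N)).
by split; rewrite [LHS]/(mulq _ _); apply: eq_quat; rewrite /= /N; field.
Qed.

Section NormDescent.
Variable R : comNzRingType.

(* The norm of g(sqrt 2) = E + O sqrt 2, with sqrt 2 adjoined formally. *)
Let N (g : {poly R}) : R := (even_poly g).[2] ^+ 2 - 2 * (odd_poly g).[2] ^+ 2.

Lemma even_odd_norm_linearM (a b : R) (g : {poly R}) :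
  N ((a%:P + b *: 'X) * g) = (a ^+ 2 - 2 * b ^+ 2) * N g.
Proof.
rewrite mulrDl mul_polyC -scalerAl ['X * g]mulrC /N.
rewrite !(even_polyD, odd_polyD, even_polyZ, odd_polyZ, even_polyMX, odd_polyMX).
by rewrite !(hornerD, hornerZ, hornerMX); ring.
Qed.

Lemma even_odd_norm_prod (I : finType) (P : pred I) (a b : I -> R) :
  N (\prod_(i | P i) ((a i)%:P + b i *: 'X)) =
  \prod_(i | P i) ((a i) ^+ 2 - 2 * (b i) ^+ 2).
Proof.
elim/big_rec2: _ => [|i y g _ IH]; last by rewrite even_odd_norm_linearM IH.
by rewrite /N even_polyC odd_polyC !(hornerC, horner0); ring.
Qed.

End NormDescent.

(** The product of the conjugates of a + bX is Galois invariant, so its coefficients lie in F.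
    Evaluated at the formal sqrt 2 it has norm p^(2m+1), where 2m + 1 is the order of the Galois
    group; dividing by p^m leaves p. The formal root spares any discussion of whether L contains
    sqrt 2. *)
Lemma norm2_descends (F : fieldType) (L : splittingFieldType F) (p : F) (a b : L) :
  galois 1%AS {:L}%AS -> odd #|'Gal({:L}%AS / 1%AS)%g| -> p != 0 ->
  a ^+ 2 - 2 * b ^+ 2 = p%:A -> exists a' b' : F, a' ^+ 2 - 2 * b' ^+ 2 = p.
Proof.
move=> gal oG p0 E; set G := 'Gal(_ / _)%g in oG.
pose g : {poly L} := \prod_(x in G) ((x a)%:P + x b *: 'X).
have gfix i : g`_i \in 1%VS.
  have /galois_fixedField fixG := gal.
  suff : g`_i \in fixedField G by rewrite /G fixG.
  apply/fixedFieldP => [|y Gy]; first exact: memvf.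
  suff {2}<- : map_poly y g = g by rewrite coef_map.
  rewrite rmorph_prod /= [RHS](reindex_inj (mulIg y)) /=.
  apply: eq_big => [x|x Gx]; first by rewrite groupMr.
  by rewrite rmorphD /= map_polyC linearZ /= map_polyX !galM ?memvf.
have /polyOver1P [h hE] : g \is a polyOver 1%VS by apply/polyOverP.
have evE : even_poly g = map_poly (in_alg L) (even_poly h).
  by apply/polyP => i; rewrite coef_map !coef_even_poly hE coef_map.
have odE : odd_poly g = map_poly (in_alg L) (odd_poly h).
  by apply/polyP => i; rewrite coef_map !coef_odd_poly hE coef_map.
have := even_odd_norm_prod (fun x => x \in G) (fun x : gal_of {:L} => x a) (fun x => x b).
rewrite -/g evE odE.
have -> : \prod_(x in G) (x a ^+ 2 - 2 * x b ^+ 2) = in_alg L (p ^+ #|G|).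
  rewrite rmorphXn -prodr_const; apply: eq_bigr => x Gx.
  have xE : x p%:A = p%:A by rewrite linearZ /= rmorph1.
  by rewrite /= -xE -E !expr2 rmorphB !rmorphM rmorph_nat.
have twoE : 2 = in_alg L 2 by rewrite rmorph_nat.
rewrite [in LHS]twoE !horner_map -!rmorphXn -[in_alg L 2 * _]rmorphM -rmorphB.
move=> /fmorph_inj; set A := (even_poly h).[2]; set B := (odd_poly h).[2] => AB.
pose m := #|G|./2; have pm0 : p ^+ m != 0 by rewrite expf_neq0.
exists (A / p ^+ m), (B / p ^+ m).
have pG : p ^+ #|G| = p * (p ^+ m) ^+ 2.
  by rewrite -exprM muln2 -exprS; congr (_ ^+ _); rewrite -[LHS]odd_double_half oG.
by rewrite !expr_div_n mulrA -mulrBl AB pG mulfK // expf_neq0.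
Qed.

(** * Ideal classes *)

(** Without fixed points, every stable set can be emptied by removing pairs x, f x, so its
    cardinality is even. *)
Lemma odd_involution_fixed (l : nat) (f : 'I_l -> 'I_l) :
  involutive f -> odd l -> exists i, f i = i.
Proof.
move=> fK ol; apply: contrapT => nf.
have {}nf i : f i != i by apply/eqP => h; apply: nf; exists i.
suff H n (A : {set 'I_l}) :
    (#|A| <= n)%N -> (forall i, i \in A -> f i \in A) -> ~~ odd #|A|.
  suff: ~~ odd #|[set: 'I_l]| by rewrite cardsT card_ord ol.
  by apply: (H l) => [|i _]; rewrite ?cardsT ?card_ord ?inE.
elim: n A => [|n IH] A; first by rewrite leqn0 => /eqP ->.
move=> leA stA; have [->|[x Ax]] := set_0Vmem A; first by rewrite cards0.
have Afx := stA x Ax.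
have Afx' : f x \in A :\ x by rewrite !inE nf.
rewrite (cardsD1 x A) Ax (cardsD1 (f x) (A :\ x)) Afx' /= negbK.
apply: IH.
  by move: leA; rewrite (cardsD1 x A) Ax (cardsD1 (f x) (A :\ x)) Afx' !add1n => /ltnW.
move=> i; rewrite !inE => /and3P [h1 h2 Ai]; rewrite stA // andbT.
by rewrite (inj_eq (inv_inj fK)) h2 -(inj_eq (inv_inj fK)) fK h1.
Qed.

Local Open Scope classical_set_scope.

Definition dilate (K : fieldType) (c : K) (J : set K) : set K :=
  [set c * x | x in J].

Section FractionalIdeals.
Variable K : fieldType.
Implicit Types (J : set K) (c : K).

Lemma dilateA c c' J : dilate c (dilate c' J) = dilate (c * c') J.
Proof.
apply/seteqP; split => [_ [_ [x Jx <-] <-]|_ [x Jx <-]].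
  by exists x => //; rewrite mulrA.
by exists (c' * x); rewrite ?mulrA //; exists x.
Qed.

Lemma dilate1 J : dilate 1 J = J.
Proof.
by apply/seteqP; split => [_ [x Jx <-]|x Jx]; [rewrite mul1r | exists x; rewrite ?mul1r].
Qed.

Lemma ideal_class_refl J : ideal_class J J.
Proof. by exists 1; rewrite ?oner_eq0 //; rewrite -[LHS]dilate1. Qed.

Lemma ideal_class_sym J J' : ideal_class J J' -> ideal_class J' J.
Proof.
move=> [c c0 ->]; exists c^-1; first by rewrite invr_eq0.
by rewrite -/(dilate c J) -/(dilate c^-1 _) dilateA mulVf // dilate1.
Qed.

Lemma ideal_class_trans J J' J'' :
  ideal_class J J' -> ideal_class J' J'' -> ideal_class J J''.
Proof.
move=> [c c0 ->] [c' c'0 ->]; exists (c' * c); first by rewrite mulf_neq0.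
exact: dilateA.
Qed.

Lemma ideal_class_eq J J' : ideal_class J = ideal_class J' <-> ideal_class J J'.
Proof.
split=> [->|h]; first exact: ideal_class_refl.
apply/seteqP; split => J''; last exact: ideal_class_trans.
by apply: ideal_class_trans; apply: ideal_class_sym.
Qed.

(** Chosen representatives turn an operation on classes into a function on a finite ordinal, where
    parity can be counted. *)
Lemma class_representatives h : has_class_number K h ->
  exists J : 'I_h -> set K, [/\ forall i, is_fractional_ideal (J i),
    forall J', is_fractional_ideal J' -> exists i, ideal_class (J i) J' &
    forall i j, ideal_class (J i) (J j) -> i = j].
Proof.
move=> /card_esym /pcard_eqP [f].
have [fun_f inj_f surj_f] := @bij _ _ _ _ f.
have /(_ _)/cid-/all_sig [J HJ] : forall i : 'I_h, exists J,
    is_fractional_ideal J /\ ideal_class J = f i.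
  by move=> i; have [J fJ <-] := fun_f i (ltn_ord i); exists J.
exists J; split.
- by move=> i; have [] := HJ i.
- move=> J' fJ'.
  have [|n hn fn] := surj_f (ideal_class J'); first by exists J'.
  exists (Ordinal hn); apply/ideal_class_eq; have [_ ->] := HJ (Ordinal hn).
  by rewrite fn.
- move=> i j /ideal_class_eq; have [_ ->] := HJ i; have [_ ->] := HJ j.
  by move=> /inj_f h1; apply/val_inj/h1; rewrite inE /=.
Qed.

End FractionalIdeals.

Lemma odd_class_number_fixed (K : fieldType) (l : nat) (T : set K -> set K) :
  has_class_number K l -> odd l ->
  (forall J, is_fractional_ideal J -> is_fractional_ideal (T J)) ->
  (forall c J, T (dilate c J) = dilate c (T J)) ->
  (forall J, is_fractional_ideal J -> ideal_class J (T (T J))) ->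
  exists J c, [/\ is_fractional_ideal J, c != 0 & T J = dilate c J].
Proof.
move=> hl ol fT dT TT; have [J [fJ exJ injJ]] := class_representatives hl.
have clT J1 J2 : ideal_class J1 J2 -> ideal_class (T J1) (T J2).
  by move=> [c c0 ->]; exists c => //; apply: dT.
have /(_ _)/cid-/all_sig [f fP] : forall i, exists j, ideal_class (J j) (T (J i)).
  by move=> i; apply/exJ/fT/fJ.
have [|i fi] := @odd_involution_fixed l f _ ol.
  move=> i; apply: injJ; apply: ideal_class_trans (fP _) _.
  apply: ideal_class_trans (clT _ _ (fP _)) _.
  exact/ideal_class_sym/TT.
by have := fP i; rewrite fi => -[c c0 Tc]; exists (J i), c.
Qed.

(** For a submodule J this is rJ + gJ, the product of J with the ideal (r, g). *)
Definition twist (K : fieldType) (r g : K) (J : set K) : set K :=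
  [set z | exists x y, [/\ J x, J y & z = r * x + g * y]].

Section Twist.
Variables (K : fieldType) (r g : K).
Hypotheses (r_neq0 : r != 0) (r_int : integers r) (g_int : integers g).

Lemma twist_fractional J : is_fractional_ideal J -> is_fractional_ideal (twist r g J).
Proof.
move=> [[J0 JD JM] Jnz [c [ic c0 cJ]]]; split.
- split.
  + by exists 0, 0; split=> //; rewrite !mulr0 addr0.
  + move=> _ _ [x [y [Jx Jy ->]]] [x' [y' [Jx' Jy' ->]]].
    exists (x + x'), (y + y'); split; [exact: JD | exact: JD | ring].
  + move=> a _ ia [x [y [Jx Jy ->]]].
    exists (a * x), (a * y); split; [exact: JM | exact: JM | ring].
- move=> E; apply: Jnz; apply/seteqP; split=> [x Jx|_ ->] //.
  have : twist r g J (r * x) by exists x, 0; split=> //; rewrite mulr0 addr0.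
  rewrite E /= => /eqP; rewrite mulf_eq0 (negbTE r_neq0) => /eqP ->.
  by [].
- exists c; split=> // _ [x [y [Jx Jy ->]]].
  have -> : c * (r * x + g * y) = r * (c * x) + g * (c * y) by ring.
  by apply: integersD; apply: integersM => //; apply: cJ.
Qed.

Lemma twist_dilate c J : twist r g (dilate c J) = dilate c (twist r g J).
Proof.
apply/seteqP; split=> [_ [_ [_ [[x Jx <-] [y Jy <-] ->]]]|_ [_ [x [y [Jx Jy ->]]] <-]].
  by exists (r * x + g * y); [exists x, y | ring].
by exists (c * x), (c * y); split; [exists x | exists y | ring].
Qed.

(** The square of (r, g) is (r^2, rg, g^2) = r (r, g, d), and r, g, d generate the unit ideal. *)
Lemma twist_twist d e f h J : integers d -> integers e -> integers f -> integers h ->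
  g ^+ 2 = r * d -> 1 = r * e + g * f + d * h -> is_submodule J ->
  twist r g (twist r g J) = dilate r J.
Proof.
move=> id ie if_ ih gE oneE [J0 JD JM]; apply/seteqP; split.
- move=> _ [_ [_ [[x [y [Jx Jy ->]]] [z [w [Jz Jw ->]]] ->]]].
  exists (r * x + g * y + (g * z + d * w)); last first.
    transitivity (r * (r * x + g * y) + (r * g * z + (r * d) * w)); first by ring.
    by rewrite -gE; ring.
  by apply: (JD); apply: (JD); apply: (JM).
- move=> _ [x Jx <-].
  exists (r * (e * x) + g * (f * x)), (r * 0 + g * (h * x)); split.
  + by exists (e * x), (f * x); split=> //; apply: JM.
  + by exists 0, (h * x); split=> //; apply: JM.
  + transitivity (r * (r * e + g * f) * x + g ^+ 2 * h * x); last by ring.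
    by rewrite gE -[LHS]mulr1 oneE; ring.
Qed.

End Twist.

(** * Squarefree integers and denominators *)

Lemma unitzE (n : int) : (n \is a GRing.unit) = (`|n|%N == 1%N).
Proof. by rewrite -[LHS]/((n == 1) || (n == -1)); apply/idP/idP; clear; lia. Qed.

Lemma squarefree_logn_le1 (n : int) : n != 0 -> squarefree n ->
  forall p, prime p -> (logn p `|n| <= 1)%N.
Proof.
move=> n0 sn p hp; rewrite leqNgt; apply/negP => h.
have : (p%:Z ^+ 2 %| n)%Z by rewrite dvdzE abszX /= pfactor_dvdn // absz_gt0.
move=> /sn; rewrite unitzE => /eqP; case: p hp {h} => [|[|p]] //.
Qed.

(* A and B are read off from the parities of the valuations of A m^2. *)
Lemma squarefree_part_eq (A B : int) (m n : nat) :
  squarefree A -> squarefree B -> A != 0 -> B != 0 -> (0 < n)%N ->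
  (`|A| * m ^ 2 = `|B| * n ^ 2)%N -> `|A|%N = `|B|%N.
Proof.
move=> sA sB A0 B0 n0 E.
have m0 : (0 < m)%N.
  rewrite lt0n; apply/eqP => m0; move: E; rewrite m0 muln0 => /esym/eqP.
  by rewrite muln_eq0 absz_eq0 (negbTE B0) /= expn_eq0 eqn0Ngt n0.
have A0' : (0 < `|A|)%N by rewrite absz_gt0.
have B0' : (0 < `|B|)%N by rewrite absz_gt0.
apply: eqn_from_log => // p.
have [hp|np] := boolP (prime p); last by rewrite [LHS]lognE [RHS]lognE (negbTE np).
have := congr1 (logn p) E; rewrite !lognM ?expn_gt0 ?m0 ?n0 // ?lognX.
have := squarefree_logn_le1 A0 sA hp; have := squarefree_logn_le1 B0 sB hp.
by clear; lia.
Qed.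

Lemma squarefree_rat_eq (A B : int) (x y : rat) :
  squarefree A -> squarefree B -> A != 0 -> B != 0 -> y != 0 ->
  `|A|%:~R * x ^+ 2 = `|B|%:~R * y ^+ 2 -> `|A|%N = `|B|%N.
Proof.
move=> sA sB A0 B0 y0 E.
have dx : (denq x)%:~R != 0 :> rat by rewrite intr_eq0 denq_neq0.
have dy : (denq y)%:~R != 0 :> rat by rewrite intr_eq0 denq_neq0.
apply: (@squarefree_part_eq A B (absz (numq x * denq y)) (absz (numq y * denq x))) => //.
  by rewrite absz_gt0 mulf_neq0 ?denq_neq0 ?numq_eq0.
suff H : `|A| * (numq x * denq y) ^+ 2 = `|B| * (numq y * denq x) ^+ 2.
  by have := congr1 absz H; rewrite !abszM !absz_id.
apply: (@intr_inj rat); rewrite !(rmorphM, rmorphXn) /=.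
move: E; rewrite -{1}[x]divq_num_den -{1}[y]divq_num_den => E.
rewrite !exprMn.
transitivity (`|A|%:~R * ((numq x)%:~R / (denq x)%:~R) ^+ 2 *
  ((denq x)%:~R ^+ 2 * (denq y)%:~R ^+ 2) : rat).
  by field.
by rewrite E; field.
Qed.

Lemma squarefree1 : squarefree 1.
Proof. by move=> n; rewrite dvdz1 abszM unitzE muln_eq1 andbb. Qed.

Lemma squarefree_prime (p : nat) : prime p -> squarefree p%:Z.
Proof.
move=> hp n; rewrite dvdzE abszX unitzE /= => h.
have /primeP [_ /(_ `|n|%N)] := hp; case/(_ _)/orP => [|//|/eqP np].
  by apply: dvdn_trans h; rewrite expnS dvdn_mulr.
move: (dvdn_leq (prime_gt0 hp) h); rewrite np; have := prime_gt1 hp.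
by clear; nia.
Qed.

(** Every power of the denominator of q divides D, so this denominator is 1. This is the rational
    case of the integrality of almost integral elements. *)
Lemma int_of_bounded_denominator (D : int) (q : rat) : D != 0 ->
  (forall n, exists m : int, D%:~R * q ^+ n = m%:~R) -> exists m : int, q = m%:~R.
Proof.
move=> D0 h; exists (numq q).
suff d1 : denq q = 1 by rewrite -[LHS]divq_num_den d1 divr1.
have dvd n : (denq q ^+ n %| D)%Z.
  have [m hm] := h n.
  have : (denq q ^+ n %| D * numq q ^+ n)%Z.
    apply/dvdzP; exists m; apply: (@intr_inj rat).
    rewrite !rmorphM !rmorphXn /= -hm -{2}[q]divq_num_den expr_div_n mulrA divfK //.
    by rewrite expf_neq0 // intr_eq0 denq_neq0.
  rewrite Gauss_dvdzl // coprimezE !abszX.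
  by apply: coprimeXl; apply: coprimeXr; rewrite coprime_sym coprime_num_den.
have := dvd `|D|%N; rewrite dvdzE abszX => /dvdn_leq; rewrite absz_gt0 D0 => /(_ isT).
have := denq_gt0 q; case: (denq q) => // -[|[|m]] //= _.
by rewrite leqNgt ltn_expl.
Qed.

(** * Maximal ideals and ramification *)

Section MaximalIdeals.
Variable K : fieldType.
Implicit Types (I P : set K) (A : set K).

Lemma ideal_integers : is_ideal (@integers K).
Proof.
split=> //; split; first exact: integers0.
- exact: integersD.
- exact: integersM.
Qed.

Lemma sub_ideal_span A : A `<=` ideal_span A.
Proof. by move=> x Ax I [_]; apply. Qed.

Lemma ideal_span_min A I : is_ideal I -> A `<=` I -> ideal_span A `<=` I.
Proof. by move=> iI AI x; apply. Qed.

Lemma ideal_span_ideal A : A `<=` @integers K -> is_ideal (ideal_span A).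
Proof.
move=> Aint; split; first exact: ideal_span_min ideal_integers Aint.
split.
- by move=> I [[_ [I0 _ _]] _].
- move=> x y Ax Ay I [iI AI]; have [_ [_ ID _]] := iI.
  by apply: ID; [apply: Ax | apply: Ay].
- move=> c x ic Ax I [iI AI]; have [_ [_ _ IM]] := iI.
  by apply: IM => //; apply: Ax.
Qed.

Lemma ideal_mul_ideal I P : is_ideal I -> is_ideal P -> is_ideal (ideal_mul I P).
Proof.
move=> [iI _] [iP _]; apply: ideal_span_ideal => _ [x Ix [y Py <-]].
by apply: integersM; [apply: iI | apply: iP].
Qed.

Lemma ideal_exp_ideal I n : is_ideal I -> is_ideal (ideal_exp I n).
Proof.
move=> iI; elim: n => [|n IH]; first exact: ideal_integers.
exact: ideal_mul_ideal.
Qed.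

Lemma mem_ideal_exp2 I x y : is_ideal I -> I x -> I y -> ideal_exp I 2 (x * y).
Proof.
move=> iI Ix Iy; apply: sub_ideal_span; exists x => //; exists y => //.
rewrite -[y]mulr1; apply: sub_ideal_span; exists y => //.
exists 1; first exact: integers1.
by rewrite mulr1.
Qed.

(** Maximality is stated as invertibility modulo P, the form in which it produces multipliers. *)
Definition maximal_ideal P := [/\ is_ideal P, ~ P 1 &
  forall x, integers x -> ~ P x -> exists2 t, integers t & P (x * t - 1)].

Lemma maximal_prime P : maximal_ideal P -> is_prime_ideal P.
Proof.
move=> [iP P1 mP]; split=> // x y ix iy Pxy.
have [Px|nPx] := pselect (P x); [by left | right].
have [t it Pt] := mP x ix nPx; have [_ [P0 PD PM]] := iP.
have -> : y = t * (x * y) + - y * (x * t - 1) by ring.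
by apply: PD; apply: PM => //; apply: integersN.
Qed.

Lemma exists_maximal_ideal I : is_ideal I -> ~ I 1 ->
  exists2 P, maximal_ideal P & I `<=` P.
Proof.
move=> iI I1.
pose good (J : set K) := J = set0 \/ [/\ is_ideal J, ~ J 1 & I `<=` J].
have [|P [gP maxP]] := @Zorn_bigcup K good.
  move=> C Cgood Ctot.
  have [h|/existsNP [J /not_implyP [CJ J0]]] := pselect (forall J, C J -> J = set0).
    left; apply/seteqP; split=> // x [J CJ Jx].
    by move: Jx; rewrite (h J CJ).
  have gJ J' : C J' -> J' <> set0 -> [/\ is_ideal J', ~ J' 1 & I `<=` J'].
    by move=> CJ' J'0; have [//|] := Cgood J' CJ'.
  have mem J' x : C J' -> J' x -> [/\ is_ideal J', ~ J' 1 & I `<=` J'].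
    by move=> CJ' J'x; apply: gJ => // E; move: J'x; rewrite E.
  right; have [iJ J1 IJ] := gJ J CJ J0; split.
  - split; first by move=> x [J' CJ' J'x]; have [[+ _] _ _] := mem _ _ CJ' J'x; apply.
    split.
    + by exists J => //; apply: IJ; have [_ []] := iI.
    + move=> x y [J1' CJ1 J1x] [J2' CJ2 J2y].
      have [[_ [_ D1 _]] _ _] := mem _ _ CJ1 J1x.
      have [[_ [_ D2 _]] _ _] := mem _ _ CJ2 J2y.
      have [le|le] := Ctot _ _ CJ1 CJ2.
        by exists J2' => //; apply: D2 => //; apply: le.
      by exists J1' => //; apply: D1 => //; apply: le.
    + move=> c x ic [J' CJ' J'x]; exists J' => //.
      by have [[_ [_ _ M]] _ _] := mem _ _ CJ' J'x; apply: M.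
  - by move=> [J' CJ' J'1]; have [_ + _] := mem _ _ CJ' J'1; apply.
  - by move=> x Ix; exists J => //; apply: IJ.
have [I0 ID IM] : is_submodule I by case: iI.
have P0 : P <> set0.
  move=> E; apply: (maxP I); last by right; split.
  rewrite E; split; first exact: sub0set.
  by move=> /(_ 0 I0).
have [//|[iP P1 IP]] := gP; exists P => //; split=> // x ix Px.
apply: contrapT => h.
have [Pint [PP0 PD PM]] := iP.
pose Q : set K := [set z | exists p c, [/\ P p, integers c & z = p + x * c]].
have PQ : P `<=` Q.
  by move=> p Pp; exists p, 0; split; rewrite ?mulr0 ?addr0 //; apply: integers0.
apply: (maxP Q); first split=> //.
  move=> QP; apply: Px; apply: QP; exists 0, 1; split=> //; first exact: integers1.
  by rewrite add0r mulr1.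
right; split; last by move=> z /IP /PQ.
- split.
    move=> _ [p [c [Pp ic ->]]]; apply: integersD; first exact: Pint.
    exact: integersM.
  split; first by apply: PQ.
  + move=> _ _ [p [c [Pp ic ->]]] [p' [c' [Pp' ic' ->]]].
    exists (p + p'), (c + c'); split; [exact: PD | exact: integersD | ring].
  + move=> a _ ia [p [c [Pp ic ->]]].
    exists (a * p), (a * c); split; [exact: PM | exact: integersM | ring].
- move=> [p [c [Pp ic E]]]; apply: h; exists c => //.
  have -> : x * c = 1 - p by rewrite E; ring.
  have -> : 1 - p - 1 = -1 * p by ring.
  apply: PM => //; apply: integersN; exact: integers1.
Qed.

Lemma maximal_ideal_int P (r : nat) (n : int) : maximal_ideal P -> prime r ->
  P r%:R -> P n%:~R -> (r %| n)%Z.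
Proof.
move=> [[_ [P0 PD PM]] P1 _] hr Pr Pn; apply/negPn/negP => rn; apply: P1.
have [v /dvdzP [w hw]] := inverse_modz hr rn.
have -> : 1 = v%:~R * n%:~R + (- w)%:~R * r%:R :> K.
  rewrite -[r%:R]/(r%:Z%:~R) -!rmorphM -rmorphD /= mulNr -hw.
  by rewrite [v * n]mulrC subKr.
by apply: PD; apply: PM => //; apply: integers_int.
Qed.

Lemma maximal_idealM P x y : maximal_ideal P -> integers x -> integers y ->
  ~ P x -> ~ P y -> ~ P (x * y).
Proof.
move=> /maximal_prime [_ _ hP] ix iy Px Py Pxy.
by have [] := hP x y ix iy Pxy.
Qed.

Lemma maximal_ideal_sqrt P x : maximal_ideal P -> integers x -> P (x ^+ 2) -> P x.
Proof.
move=> mP ix Px2; apply: contrapT => Px.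
by apply: (maximal_idealM mP ix ix Px Px); rewrite -expr2.
Qed.

End MaximalIdeals.

(* At P, the ideal (P cap F) O_L is locally generated by the square of an
   element of P, hence lies in P^2. *)
Lemma square_uniformizer_ramified (F : fieldType) (L : fieldExtType F)
    (P : set L) (b : L) :
  unramified_finite L -> maximal_ideal P -> P b -> b != 0 ->
  (forall x : F, integers x -> P x%:A -> exists c y : L,
    [/\ integers c, ~ P c, integers y & c * x%:A = b ^+ 2 * y]) -> False.
Proof.
move=> unr mP Pb b0 loc.
have pP := maximal_prime mP; have [iP P1 maxP] := mP.
have Pn0 : P <> [set 0] by move=> E; move: Pb; rewrite E => /= /eqP; apply/negP.
have [_] := unr P pP Pn0; apply.
have [_ [Q0 QD QM]] := ideal_exp_ideal 2 iP.
apply: ideal_span_min; first exact: ideal_exp_ideal.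
move=> _ [x [ix Px] <-].
have [c [y [ic Pc iy E]]] := loc x ix Px.
have [t it Pt] := maxP c ic Pc.
have -> : x%:A = t * y * (b * b) + (- 1) * ((c * t - 1) * x%:A).
  transitivity (t * (c * x%:A) + (- 1) * ((c * t - 1) * x%:A)); first by ring.
  by rewrite E; ring.
apply: QD; first by apply: QM; [apply: integersM | apply: mem_ideal_exp2].
apply: QM; first by apply: integersN; exact: integers1.
exact: mem_ideal_exp2.
Qed.

Lemma exists_maximal_ideal2 (K : fieldType) (u v : K) : integers u -> integers v ->
  (forall a b, integers a -> integers b -> u * a + v * b <> 1) ->
  exists P : set K, [/\ maximal_ideal P, P u & P v].
Proof.
move=> iu iv h; pose I : set K :=
  [set z | exists a b, [/\ integers a, integers b & z = u * a + v * b]].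
have [||P mP IP] := @exists_maximal_ideal K I.
- split.
    by move=> _ [a [b [ia ib ->]]]; apply: integersD; apply: integersM.
  split.
  + by exists 0, 0; split; rewrite ?mulr0 ?addr0 //; apply: integers0.
  + move=> _ _ [a [b [ia ib ->]]] [a' [b' [ia' ib' ->]]].
    exists (a + a'), (b + b'); split; [exact: integersD | exact: integersD | ring].
  + move=> c _ ic [a [b [ia ib ->]]].
    exists (c * a), (c * b); split; [exact: integersM | exact: integersM | ring].
- by move=> [a [b [ia ib E]]]; apply: (h a b).
exists P; split=> //; apply: IP.
- by exists 1, 0; split; [exact: integers1 | exact: integers0 | ring].
- by exists 0, 1; split; [exact: integers0 | exact: integers1 | ring].
Qed.

(** * Prime valuations of integers *)

Lemma int_pfactor (r : nat) (m : int) : prime r -> m != 0 ->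
  exists2 m' : int, m = r%:Z ^+ logn r `|m| * m' & ~~ (r %| m')%Z.
Proof.
move=> hr m0; have m0' : (0 < `|m|)%N by rewrite absz_gt0.
have /dvdzP [m' mE] : (r%:Z ^+ logn r `|m| %| m)%Z.
  by rewrite dvdzE abszX pfactor_dvdnn.
exists m'; first by rewrite {1}mE mulrC.
apply/negP => /dvdzP [m'' m'E].
have : (r ^ (logn r `|m|).+1 %| `|m|)%N.
  rewrite {2}mE m'E !abszM abszX /= -mulnA -expnS; exact: dvdn_mull.
by rewrite pfactor_dvdn // ltnn.
Qed.

Lemma square_of_even_logn (n : nat) : (0 < n)%N ->
  (forall p, prime p -> ~~ odd (logn p n)) -> exists k, n = (k ^ 2)%N.
Proof.
have [m] := ubnP n; elim: m n => // m IH n lt_n n0 ev.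
have [n1|n1] := leqP n 1; first by exists 1%N; move: n0 n1; clear; lia.
have hp := pdiv_prime n1; set p := pdiv n in hp.
have l2 : (1 < logn p n)%N.
  have : (0 < logn p n)%N by rewrite logn_gt0 mem_primes hp n0 pdiv_dvd.
  by have := ev p hp; case: (logn p n) => [|[|]].
have /dvdnP [n' nE] : (p ^ 2 %| n)%N by rewrite pfactor_dvdn.
have n'0 : (0 < n')%N by move: n0; rewrite nE muln_gt0 => /andP [].
have evn r : prime r -> ~~ odd (logn r n').
  move=> hr; have := ev r hr; rewrite nE -mulnn lognM ?muln_gt0 ?(prime_gt0 hp) //.
  by rewrite lognM ?(prime_gt0 hp) // !oddD addbb addbF.
have lt_n' : (n' < m)%N.
  have p2 : (1 < p ^ 2)%N by rewrite -(exp1n 2) ltn_exp2r // prime_gt1.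
  by move: lt_n; rewrite ltnS nE; apply: leq_trans; apply: ltn_Pmulr.
have [k kE] := IH n' lt_n' n'0 evn.
by exists (k * p)%N; rewrite nE kE expnMn.
Qed.

(** * Quadratic fields *)

Section QuadraticField.
Variables (F : fieldExtType rat) (d : int) (s : F).
Hypothesis sqr_s : s ^+ 2 = d%:~R.
Hypothesis gen_s : <<1; s>>%VS = fullv.
Hypothesis dimF : \dim {:F} = 2%N.

Let X : 2.-tuple F := [tuple s; 1].
Definition quad_re (z : F) : rat := coord X (lift ord0 ord0) z.
Definition quad_im (z : F) : rat := coord X ord0 z.
Definition quad (x y : rat) : F := x%:A + y *: s.

Let X_free : free X.
Proof.
rewrite /X /= free_cons span_seq1 seq1_free oner_eq0 andbT.
apply/negP => s1; have : <<1; s>>%VS = 1%VS :> {vspace F}.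
  by apply/Fadjoin_idP.
by rewrite gen_s => /(congr1 (fun U => \dim U)); rewrite dimF dimv1.
Qed.

Lemma quadE z : quad (quad_re z) (quad_im z) = z.
Proof.
have bX : basis_of fullv X by rewrite basisEfree X_free subvf dimF size_tuple.
have := coord_basis bX (memvf z); rewrite big_ord_recl big_ord1 /= => zE.
by rewrite [RHS]zE addrC.
Qed.

Lemma quad_inj x y x' y' : quad x y = quad x' y' -> x = x' /\ y = y'.
Proof.
have coordX a b : quad_re (quad a b) = a /\ quad_im (quad a b) = b.
  have E : quad a b = \sum_(i < 2) [:: b; a]`_i *: X`_i.
    by rewrite big_ord_recl big_ord1 /= addrC.
  by rewrite /quad_re /quad_im E !(coord_sum_free _ _ X_free).
have [h1 h2] := coordX x y; have [h3 h4] := coordX x' y'.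
by move=> h; split; [rewrite -h3 -h h1 | rewrite -h4 -h h2].
Qed.

Lemma quad_reE x y : quad_re (quad x y) = x.
Proof. by have [] := quad_inj (quadE (quad x y)). Qed.

Lemma quad_imE x y : quad_im (quad x y) = y.
Proof. by have [] := quad_inj (quadE (quad x y)). Qed.

Lemma quadD x y x' y' : quad x y + quad x' y' = quad (x + x') (y + y').
Proof. by rewrite /quad !scalerDl; ring. Qed.

Lemma quadN x y : - quad x y = quad (- x) (- y).
Proof. by rewrite /quad !scaleNr opprD. Qed.

Lemma quadM x y x' y' :
  quad x y * quad x' y' = quad (x * x' + d%:~R * (y * y')) (x * y' + y * x').
Proof.
have dE : (d%:~R : rat)%:A = d%:~R :> F := rmorph_int (in_alg F) d.
rewrite /quad -!(mulr_algl _ s) -!in_algE !rmorphD !rmorphM /= dE -sqr_s.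
by ring.
Qed.

Lemma quad_rat x : quad x 0 = x%:A.
Proof. by rewrite /quad scale0r addr0. Qed.

Lemma quad_int (n : int) : quad n%:~R 0 = n%:~R.
Proof. by rewrite quad_rat; exact: (rmorph_int (in_alg F)). Qed.

Lemma quad_s : quad 0 1 = s.
Proof. by rewrite /quad scale0r add0r scale1r. Qed.

(** The universal property of F = Q(s). It shows that conjugation preserves integrality and, for d
    >= 0, it yields a real embedding. *)
Lemma quad_rmorph (K : fieldType) (f0 : {rmorphism rat -> K}) (t : K) :
  t ^+ 2 = d%:~R ->
  exists f : {rmorphism F -> K}, forall x y, f (quad x y) = f0 x + f0 y * t.
Proof.
move=> sqr_t; pose f z := f0 (quad_re z) + f0 (quad_im z) * t.
have fE x y : f (quad x y) = f0 x + f0 y * t by rewrite /f quad_reE quad_imE.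
have addf : zmod_morphism f.
  move=> z w; rewrite -(quadE z) -(quadE w) quadN quadD !fE !rmorphB /=; ring.
have mulf : monoid_morphism f.
  split=> [|z w]; first by rewrite -[1](quad_int 1) fE rmorph0 mul0r addr0 rmorph1.
  rewrite -(quadE z) -(quadE w) quadM !fE !rmorphD !rmorphM /= rmorph_int -sqr_t; ring.
pose A := GRing.isZmodMorphism.Build _ _ f addf.
pose M := GRing.isMonoidMorphism.Build _ _ f mulf.
by exists (HB.pack_for {rmorphism F -> K} f A M).
Qed.

Definition quad_conj (z : F) : F := quad (quad_re z) (- quad_im z).
Definition quad_norm (z : F) : rat := quad_re z ^+ 2 - d%:~R * quad_im z ^+ 2.

Lemma quad_conjE x y : quad_conj (quad x y) = quad x (- y).
Proof. by rewrite /quad_conj quad_reE quad_imE. Qed.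

Lemma quad_normE x y : quad_norm (quad x y) = x ^+ 2 - d%:~R * y ^+ 2.
Proof. by rewrite /quad_norm quad_reE quad_imE. Qed.

Lemma mul_conj z : z * quad_conj z = (quad_norm z)%:A.
Proof.
by rewrite -(quadE z) quad_conjE quadM quad_normE -quad_rat; congr quad; ring.
Qed.

Lemma add_conj z : z + quad_conj z = (2 * quad_re z)%:A.
Proof.
rewrite -{1 2}(quadE z) quad_conjE quadD -quad_rat; congr quad; ring.
Qed.

Lemma quad_normM z w : quad_norm (z * w) = quad_norm z * quad_norm w.
Proof.
by rewrite -(quadE z) -(quadE w) quadM !quad_normE; ring.
Qed.

Lemma quad_norm_eq0 z : (quad_norm z == 0) = (z == 0).
Proof.
apply/eqP/eqP => [h|->]; last first.
  by rewrite -[0](quad_int 0) quad_normE expr0n mulr0 subr0.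
have := mul_conj z; rewrite h scale0r => /eqP.
rewrite mulf_eq0 => /orP [/eqP //|/eqP].
rewrite -{2}(quadE z) /quad_conj -[0](quad_int 0) => /quad_inj [-> /eqP].
by rewrite oppr_eq0 => /eqP ->.
Qed.

Lemma quad_int_eq0 (n : int) : (n%:~R == 0 :> F) = (n == 0).
Proof.
by rewrite -quad_norm_eq0 -quad_int quad_normE expr0n mulr0 subr0 sqrf_eq0 intr_eq0.
Qed.

Lemma integers_conj z : integers z -> integers (quad_conj z).
Proof.
have [|f fE] := @quad_rmorph F (in_alg F) (- s); first by rewrite sqrrN.
have -> : quad_conj z = f z.
  by rewrite -(quadE z) quad_conjE fE /quad mulrN scaleNr mulr_algl.
by move=> hz; apply/integers_rmorph.
Qed.

Lemma integers_alg (x : rat) : integers (x%:A : F) -> exists n : int, x = n%:~R.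
Proof. by move=> /(integers_rmorph (in_alg F)); exact: integers_rat. Qed.

Lemma integers_norm z : integers z -> exists n : int, quad_norm z = n%:~R.
Proof.
move=> hz; apply: integers_alg; rewrite -mul_conj.
by apply: integersM => //; apply: integers_conj.
Qed.

Lemma integers_trace z : integers z -> exists n : int, 2 * quad_re z = n%:~R.
Proof.
move=> hz; apply: integers_alg; rewrite -add_conj.
by apply: integersD => //; apply: integers_conj.
Qed.

Lemma integers_s : integers s.
Proof. by apply: integers_sqrt; rewrite sqr_s; apply: integers_int. Qed.

Lemma integers_quad_int (m n : int) : integers (quad m%:~R n%:~R).
Proof.
rewrite /quad; apply: integersD.
  by rewrite -quad_rat quad_int; apply: integers_int.
rewrite -mulr_algl; apply: integersM; last exact: integers_s.
by rewrite -quad_rat quad_int; apply: integers_int.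
Qed.

Lemma imaginary_disc_lt0 : imaginary_quadratic F -> d < 0.
Proof.
move=> [_ im]; rewrite ltNge; apply/negP => d0.
have [|f fE] := @quad_rmorph algC (ratr : {rmorphism rat -> algC}) (sqrtC d%:~R).
  by rewrite sqrtCK.
have [z] := im f; rewrite -(quadE z) fE /=; case/negP.
apply: realD; first exact: (Creal_Crat (Crat_rat _)).
apply: realM; first exact: (Creal_Crat (Crat_rat _)).
by rewrite ger0_real // sqrtC_ge0 ler0z.
Qed.

Lemma quad_no_norm2 (p : nat) : prime p -> odd p -> p = 3 %[mod 8] ->
  (~~ (p %| d)%Z /\ sqmod d p) \/ (d = 1 %[mod 8])%Z ->
  ~ exists a b : F, a ^+ 2 - 2 * b ^+ 2 = p%:R.
Proof.
move=> hp po hp8 hd [a [b E]].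
set x := quad_re a; set y := quad_im a; set z := quad_re b; set w := quad_im b.
have [E1 E2] : x * x + d%:~R * (y * y) - 2 * (z * z + d%:~R * (w * w)) = p%:R /\
    x * y + y * x - 2 * (z * w + w * z) = 0.
  apply: quad_inj; rewrite (quad_int p) -[RHS]/(p%:R) -E.
  rewrite -(quadE a) -(quadE b) !expr2 -/x -/y -/z -/w !quadM.
  have -> : 2 = quad 2%:~R 0 :> F by rewrite quad_int.
  by rewrite quadM quadN quadD; congr quad; ring.
(* The common denominator becomes the c of [no_norm2_split], which would have to vanish. *)
pose D := denq x * denq y * denq z * denq w.
have D0 : D != 0 by rewrite !mulf_neq0 ?denq_neq0.
have dn (t : rat) : (denq t)%:~R * t = (numq t)%:~R.
  by rewrite -{2}[t]divq_num_den mulrC divfK // intr_eq0 denq_neq0.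
have clear_den (t : rat) : (denq t %| D)%Z -> exists n : int, n%:~R = D%:~R * t.
  by move=> /dvdzP [m ->]; exists (m * numq t); rewrite !rmorphM /= -mulrA dn.
have [|a1 h1] := clear_den x; first by rewrite /D -!mulrA dvdz_mulr.
have [|a2 h2] := clear_den y; first by rewrite /D -!mulrA dvdz_mull // dvdz_mulr.
have [|b1 h3] := clear_den z.
  by rewrite /D -!mulrA dvdz_mull // dvdz_mull // dvdz_mulr.
have [|b2 h4] := clear_den w; first by rewrite /D dvdz_mull.
clearbody D; case/eqP: D0.
apply: (@no_norm2_split p d a1 a2 b1 b2 D hp po hp8 hd).
  apply: (@intr_inj rat); rewrite !(rmorphD, rmorphN, rmorphM, rmorphXn) /= h1 h2 h3 h4.
  by rewrite -[p%:~R]/(p%:R) -E1; ring.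
apply: (@intr_inj rat); rewrite !(rmorphD, rmorphN, rmorphM, rmorphXn) /= h1 h2 h3 h4.
have {}E2 : x * y = 2 * (z * w) by move: E2; lra.
transitivity (D%:~R * D%:~R * (x * y)); first by ring.
by rewrite E2; ring.
Qed.

Lemma quad_norm2_nonsplit (p q : nat) : prime p -> prime q -> d = - q%:Z ->
  p = 3 %[mod 8] -> q = 3 %[mod 8] -> p = q \/ ~ sqmod d p ->
  exists a b : F, a ^+ 2 - 2 * b ^+ 2 = p%:R.
Proof.
move=> hp hq dq hp8 hq8 hpq.
have qE : q%:R = - s ^+ 2 :> F by rewrite sqr_s dq rmorphN opprK.
have [<-|npq] := eqVneq q p; first by exists s, s; rewrite qE; ring.
have nr : ~ sqmod (- q%:Z) p.
  by rewrite -dq; case: hpq => // pq; rewrite pq eqxx in npq.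
have npq' : p != q by rewrite eq_sym.
have [x [y [z [z0 E]]]] := ternary_2qp hp hq npq' hp8 hq8 nr.
have zF : z%:~R != 0 :> F.
  by rewrite quad_int_eq0.
pose U := x%:~R / z%:~R : F; pose S := s * (y%:~R / z%:~R).
(* Here p = 2U^2 - S^2; multiplying S + U sqrt 2 by 1 + sqrt 2, of norm -1, corrects the sign. *)
exists (S + 2 * U), (S + U).
have EF : 2 * x%:~R ^+ 2 - s ^+ 2 * y%:~R ^+ 2 = p%:R * z%:~R ^+ 2 :> F.
  have := congr1 (fun n : int => n%:~R : F) E.
  rewrite !(rmorphD, rmorphM, rmorphXn) /= -[q%:~R]/(q%:R) -[p%:~R]/(p%:R) qE => <-.
  by ring.
transitivity ((2 * x%:~R ^+ 2 - s ^+ 2 * y%:~R ^+ 2) / z%:~R ^+ 2).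
  by rewrite /S /U; field.
by rewrite EF mulfK // expf_neq0.
Qed.

(** * Scalars preserving an ideal, and odd class numbers *)

Hypothesis d_sqfree : squarefree d.
Hypothesis d_lt0 : d < 0.
Implicit Types (u c : F) (J : set F).

Lemma quad_norm_ge0 z : 0 <= quad_norm z.
Proof.
rewrite /quad_norm -mulNr; apply: addr_ge0; first exact: sqr_ge0.
apply: mulr_ge0; last exact: sqr_ge0.
by rewrite oppr_ge0 lerz0 ltW.
Qed.

Lemma fractional_nonzero (K : fieldType) (J : set K) : is_fractional_ideal J ->
  exists2 x, J x & x != 0.
Proof.
move=> [[J0 _ _] Jn0 _]; apply: contrapT => h; apply: Jn0.
apply/seteqP; split=> x /= => [Jx|-> //].
by apply/eqP/negPn/negP => x0; apply: h; exists x.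
Qed.

(** If x0 is a nonzero element of J and c clears the denominators of J, then all c u^n x0 are
    integral. So u has bounded denominators, and rational quantities such as its norm are
    integers. *)
Lemma fractional_stabilizer u J : is_fractional_ideal J ->
  (forall x, J x -> J (u * x)) ->
  exists2 w, w != 0 & forall n, integers (w * u ^+ n).
Proof.
move=> fJ uJ; have [x0 Jx0 x0n] := fractional_nonzero fJ.
have [_ _ [c [ic c0 cJ]]] := fJ.
exists (c * x0); first by rewrite mulf_neq0.
have Jn n : J (u ^+ n * x0).
  by elim: n => [|n IH]; rewrite ?expr0 ?mul1r // exprS -mulrA; apply: uJ.
by move=> n; rewrite -mulrA [x0 * _]mulrC; apply: cJ.
Qed.

Lemma stabilizer_norm u J : is_fractional_ideal J ->
  (forall x, J x -> J (u * x)) -> exists n : int, quad_norm u = n%:~R.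
Proof.
move=> fJ uJ; have [w w0 hw] := fractional_stabilizer fJ uJ.
have [D hD] : exists D : int, quad_norm w = D%:~R.
  by apply: integers_norm; rewrite -[w]mulr1 -(expr0 u).
apply: (@int_of_bounded_denominator D).
  by move: w0; rewrite -quad_norm_eq0 hD intr_eq0.
move=> n; have [m hm] := integers_norm (hw n); exists m.
rewrite -hm quad_normM hD; congr (_ * _).
elim: n {hm} => [|n IH]; last by rewrite !exprS quad_normM IH.
by rewrite !expr0 -[1 in RHS](quad_int 1) quad_normE expr0n mulr0 subr0.
Qed.

Lemma stabilizer_rat (q : rat) J : is_fractional_ideal J ->
  (forall x, J x -> J (q%:A * x)) -> exists n : int, q = n%:~R.
Proof.
move=> fJ qJ; have [w w0 hw] := fractional_stabilizer fJ qJ.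
have [D hD] : exists D : int, quad_norm w = D%:~R.
  by apply: integers_norm; rewrite -[w]mulr1 -(expr0 q%:A).
apply: (@int_of_bounded_denominator D).
  by move: w0; rewrite -quad_norm_eq0 hD intr_eq0.
move=> n; apply: integers_alg.
have -> : (D%:~R * q ^+ n)%:A = quad_conj w * (w * q%:A ^+ n) :> F.
  by rewrite mulrA [_ * w]mulrC mul_conj hD -!in_algE rmorphM rmorphXn.
apply: integersM => //; apply: integers_conj.
by rewrite -[w]mulr1 -(expr0 q%:A).
Qed.

(** Both u and its inverse preserve J, so u has norm 1 and integral trace t, with |d| (2y)^2 = 4 -
    t^2 for y its coordinate on s. Apart from t = 2 and t = -2, the squarefree part of 4 - t^2 is 1
    or 3, which are the excluded values of -d. *)
Lemma ideal_unit u J : d != -1 -> d != -3 -> is_fractional_ideal J ->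
  dilate u J = J -> u = 1 \/ u = -1.
Proof.
move=> d1 d3 fJ uJ.
have u0 : u != 0.
  have [x Jx x0] := fractional_nonzero fJ; apply: contraNneq x0 => u0.
  by move: Jx; rewrite -uJ => -[y _ <-]; rewrite u0 mul0r.
have uJ' : dilate u^-1 J = J by rewrite -{1}uJ dilateA mulVf // dilate1.
have stab x : J x -> J (u * x) by move=> Jx; rewrite -uJ; exists x.
have stab' x : J x -> J (u^-1 * x) by move=> Jx; rewrite -uJ'; exists x.
have [n hn] := stabilizer_norm fJ stab.
have [n' hn'] := stabilizer_norm fJ stab'.
have nn' : n * n' = 1.
  apply: (@intr_inj rat); rewrite rmorphM /= -hn -hn' -quad_normM mulfV //.
  by rewrite -[1](quad_int 1) quad_normE expr0n mulr0 subr0 expr1n.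
have nge0 : 0 <= n by rewrite -(ler0z rat) -hn quad_norm_ge0.
have n1 : n = 1.
  have : n \is a GRing.unit by apply/unitrP; exists n'; rewrite mulrC nn'.
  by rewrite unitzE; move: nge0; clear; lia.
have uV : u^-1 = quad_conj u.
  by apply: (mulfI u0); rewrite mulfV // mul_conj hn n1 scale1r.
have [t ht] : exists t : int, 2 * quad_re u = t%:~R.
  apply: (@stabilizer_rat _ J) => // x Jx.
  rewrite -add_conj -uV mulrDl; have [[_ JD _] _ _] := fJ.
  by apply: JD; [apply: stab | apply: stab'].
set x := quad_re u in ht; set y := quad_im u.
have N1 : x ^+ 2 - d%:~R * y ^+ 2 = 1 by rewrite -[LHS]/(quad_norm u) hn n1.
have xE : x = t%:~R / 2 by rewrite -ht mulrAC mulfV ?mul1r.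
have main : `|d|%:~R * (2 * y) ^+ 2 = (4 - t ^+ 2)%:~R :> rat.
  have -> : `|d| = - d by rewrite ltr0_norm.
  rewrite !(rmorphN, rmorphB, rmorphXn) /= -ht.
  transitivity (4 * (x ^+ 2 - d%:~R * y ^+ 2) - (2 * x) ^+ 2); first by ring.
  by rewrite N1; ring.
have t4 : 0 <= 4 - t ^+ 2.
  by rewrite -(ler0z rat) -main mulr_ge0 ?sqr_ge0 // ler0z.
have tcase : t = 2 \/ t = -2 \/ t = 0 \/ t ^+ 2 = 1 by move: t4; clear; nia.
have uE : u = quad x y by rewrite quadE.
have dn0 : d != 0 by rewrite lt_eqF.
have y0 : 4 - t ^+ 2 = 0 -> y = 0.
  move=> h; move: main; rewrite h => /eqP.
  rewrite mulf_eq0 intr_eq0 normr_eq0 (negbTE dn0) /=.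
  by rewrite sqrf_eq0 mulf_eq0 => /eqP.
case: tcase => [t2|[t2|[t0|t1]]].
- left; rewrite uE y0 ?t2 // xE t2; exact: (quad_int 1).
- right; rewrite uE y0 ?t2 // xE t2; exact: (quad_int (-1)).
- have := @squarefree_rat_eq d 1 (2 * y) 2 d_sqfree squarefree1 dn0 isT isT.
  rewrite main t0 => /(_ _) h; exfalso; move/eqP: d1; apply.
  have := h ltac:(by []); move: d_lt0; clear; lia.
- have sq3 := @squarefree_prime 3 isT.
  have := @squarefree_rat_eq d 3 (2 * y) 1 d_sqfree sq3 dn0 isT isT.
  rewrite main t1 => /(_ _) h; exfalso; move/eqP: d3; apply.
  have := h ltac:(by []); move: d_lt0; clear; lia.
Qed.

(** The quotient c^2 / r preserves J, so c^2 is r or -r. Being rational, c^2 is the square of a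
    rational x or of y s; the former would make the prime r a rational square, and the latter
    compares the squarefree parts of d y^2 and r. *)
Lemma dilate_sqr_prime (r : nat) c J : prime r -> d != -1 -> d != -3 ->
  is_fractional_ideal J -> c != 0 -> dilate (c ^+ 2) J = dilate r%:R J ->
  d = - r%:Z.
Proof.
move=> hr d1 d3 fJ c0 E.
have dn0 : d != 0 by rewrite lt_eqF.
have r0 : r%:R != 0 :> F.
  by rewrite -[r%:R]/(r%:Z%:~R) quad_int_eq0; case: (r) hr.
have : dilate (c ^+ 2 / r%:R) J = J.
  by rewrite mulrC -dilateA E dilateA mulVf // dilate1.
move=> /(ideal_unit d1 d3 fJ) h.
have {h} [e [e1 hc]] : exists e : int, (e = 1 \/ e = -1) /\ c ^+ 2 = (e * r)%:~R.
  by case: h => h; [exists 1 | exists (-1)]; split; auto;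
    rewrite rmorphM /= -[c ^+ 2](divfK r0) h.
move: hc; rewrite -(quadE c) expr2 quadM -quad_int => /quad_inj.
set x := quad_re c; set y := quad_im c => -[hre him].
have rp0 : 0 < r%:~R :> rat by rewrite ltr0z; case: (r) hr.
have rn0 : r%:Z != 0 by case: (r) hr.
have absr : `|r%:Z|%:~R = r%:~R :> rat by [].
have sr := squarefree_prime hr.
have dy : d%:~R * (y * y) <= 0.
  by rewrite -expr2; apply: mulr_le0_ge0; [rewrite lerz0 ltW | apply: sqr_ge0].
have xx : 0 <= x * x by rewrite -expr2 sqr_ge0.
have [x0|x0] := eqVneq x 0.
  move: hre; rewrite x0 mul0r add0r => hre.
  have eN : e = -1.
    case: e1 => // e1; move: dy; rewrite hre e1 mul1r => dy.
    by have := lt_le_trans rp0 dy; rewrite ltxx.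
  have := @squarefree_rat_eq d r y 1 d_sqfree sr dn0 rn0 (oner_neq0 _).
  rewrite absr expr1n mulr1 ltr0_norm // rmorphN /= mulNr expr2 hre eN.
  rewrite mulN1r rmorphN /= opprK => /(_ erefl).
  by move: d_lt0; clear; lia.
have y0 : y = 0.
  move: him => /eqP; rewrite mulrC -mulr2n -mulr_natl !mulf_eq0 (negbTE x0) orbF.
  by rewrite pnatr_eq0 /= => /eqP.
move: hre; rewrite y0 !mulr0 addr0 => hre.
have eP : e = 1.
  case: e1 => // e1; move: xx; rewrite hre e1 mulN1r rmorphN oppr_ge0 => xx.
  by have := lt_le_trans rp0 xx; rewrite ltxx.
have := @squarefree_rat_eq 1 r x 1 squarefree1 sr isT rn0 (oner_neq0 _).
rewrite absr expr1n mulr1 expr2 hre eP !mul1r => /(_ erefl) r1.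
by have := prime_gt1 hr; rewrite -[r]/(absz r) -r1.
Qed.

(* The class of the ideal (r, g), whose square is (r), would be a translation
   of order 2 without fixed points on the class group. *)
Lemma no_twist (l r : nat) (g a b e f : F) :
  has_class_number F l -> odd l -> prime r -> d != -1 -> d != -3 ->
  integers g -> integers a -> integers b -> integers e -> integers f ->
  g ^+ 2 = r%:R * a -> 1 = r%:R * b + g * e + a * f -> d = - r%:Z.
Proof.
move=> hl ol hr d1 d3 ig ia ib ie if_ gE oneE.
have ir : integers (r%:R : F) by exact: (integers_int F r).
have r0 : r%:R != 0 :> F.
  by rewrite -[r%:R]/(r%:Z%:~R) quad_int_eq0; case: (r) hr.
have TT J : is_fractional_ideal J -> twist r%:R g (twist r%:R g J) = dilate r%:R J.
  by move=> [sJ _ _]; apply: (twist_twist ir ig ia ib ie if_).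
have [|J [c [fJ c0 TJ]]] := odd_class_number_fixed hl ol
  (fun J fJ => twist_fractional r0 ir ig fJ) (twist_dilate r%:R g).
  by move=> J fJ; rewrite TT //; exists r%:R.
apply: (dilate_sqr_prime hr d1 d3 fJ c0).
by rewrite -TT // TJ twist_dilate TJ dilateA expr2.
Qed.

(* An element of J of least norm generates J, as Z[s] is Euclidean. *)
Lemma quad_euclid (J J' : set F) : -2 <= d -> is_fractional_ideal J ->
  is_fractional_ideal J' -> ideal_class J J'.
Proof.
move=> d2; have dn : d = -1 \/ d = -2 by move: d_lt0 d2; clear; lia.
suff gen I0 : is_fractional_ideal I0 -> exists2 y, y != 0 &
    I0 = dilate y [set z | exists m n : int, z = quad m%:~R n%:~R].
  move=> fJ fJ'; have [y y0 ->] := gen _ fJ; have [y' y'0 ->] := gen _ fJ'.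
  by exists (y' / y); rewrite ?mulf_neq0 ?invr_eq0 // -/(dilate _ _) dilateA divfK.
move=> fI; have [x0 Ix0 x0n] := fractional_nonzero fI.
have [[I0_ ID IM] _ [c [ic c0 cI]]] := fI.
have size_of y : I0 y -> exists k : nat, quad_norm (c * y) = k%:R.
  move=> Iy; have [n hn] := integers_norm (cI _ Iy).
  by exists `|n|%N; rewrite hn natr_absz ger0_norm // -(ler0z rat) -hn quad_norm_ge0.
have [k0 hk0] := size_of _ Ix0.
have [y [Iy yn ymin]] : exists y, [/\ I0 y, y != 0 &
    forall z, I0 z -> quad_norm z < quad_norm y -> z = 0].
  have [n] := ubnP k0; elim: n x0 x0n Ix0 k0 hk0 => // n IH y yn Iy k hk lt_k.
  have [h|] := pselect (forall z, I0 z -> quad_norm z < quad_norm y -> z = 0).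
    by exists y.
  move=> /existsNP [z] /not_implyP [Iz] /not_implyP [ltz /eqP z0].
  have [k' hk'] := size_of _ Iz.
  apply: (IH z z0 Iz k' hk'); rewrite ltnS in lt_k; apply: leq_trans lt_k.
  rewrite -(ltr_nat rat) -hk -hk' !quad_normM ltr_pM2l // lt_neqAle quad_norm_ge0 andbT.
  by rewrite eq_sym quad_norm_eq0.
exists y => //; apply/seteqP; split=> [x Ix|_ [_ [m [n ->]] <-]]; last first.
  by rewrite mulrC; apply: IM => //; apply: integers_quad_int.
have near (q : rat) : exists m : int, (q - m%:~R) ^+ 2 <= 1 / 4.
  exists (Num.floor (q + 1 / 2)).
  have := floor_le_tmp (q + 1 / 2); have := floorD1_gt (q + 1 / 2).
  rewrite rmorphD /= => h1 h2.
  rewrite -subr_ge0; set w := (_%:~R) in h1 h2 *.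
  have -> : 1 / 4 - (q - w) ^+ 2 = (w - (q - 1 / 2)) * (q + 1 / 2 - w) by field.
  by apply: mulr_ge0; lra.
have [m hm] := near (quad_re (x / y)); have [n hn] := near (quad_im (x / y)).
suff z0 : x - quad m%:~R n%:~R * y = 0.
  exists (quad m%:~R n%:~R); first by exists m, n.
  by rewrite mulrC; apply/eqP; rewrite eq_sym -subr_eq0 z0.
apply: ymin.
  apply: ID => //; rewrite -mulNr; apply: IM => //; apply: integersN; exact: integers_quad_int.
have -> : x - quad m%:~R n%:~R * y = (x / y - quad m%:~R n%:~R) * y.
  by rewrite mulrBl divfK.
rewrite quad_normM -[ltRHS]mul1r ltr_pM2r; last first.
  by rewrite lt_neqAle quad_norm_ge0 andbT eq_sym quad_norm_eq0.
rewrite -(quadE (x / y)) quadN quadD quad_normE.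
(* Rounding both coordinates leaves a remainder of norm at most (1 + |d|) / 4 <= 3 / 4. *)
case: dn => ->; move: hm hn; rewrite ?rmorphN /=; lra.
Qed.

Lemma odd_class_number_disc (l : nat) : has_class_number F l -> odd l -> (1 < l)%N ->
  exists q : nat, [/\ prime q, q = 3 %[mod 4] & d = - q%:Z].
Proof.
move=> hl ol l1.
have dm2 : d < -2.
  rewrite ltNge; apply/negP => d2.
  have [J [fJ _ injJ]] := class_representatives hl.
  pose i0 := Ordinal (ltnW l1); pose i1 := Ordinal l1.
  by have := injJ i0 i1 (quad_euclid d2 (fJ i0) (fJ i1)) => /(congr1 val).
have d1 : d != -1 by move: dm2; clear; lia.
(* The field with extra units is set aside; it has the required form with q = 3. *)
have [d3|d3] := eqVneq d (-3); first by exists 3%N.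
have [q [hq oq qd]] : exists q : nat, [/\ prime q, odd q & (q %| d)%Z].
  apply: contrapT => h; have h2 p : prime p -> (p %| `|d|)%N -> p = 2%N.
    move=> hp pd; case: (even_prime hp) => // op.
    by case: h; exists p; rewrite dvdzE.
  have d0 : (0 < `|d|)%N by move: d_lt0; clear; lia.
  have nat2 : (2.-nat `|d|)%N by apply/pnatP => // p hp /h2 -> //.
  have := squarefree_logn_le1 (ltr0_neq0 d_lt0) d_sqfree (isT : prime 2).
  have := part_pnat_id nat2; rewrite p_part => dE h3.
  have : (`|d| <= 2)%N by rewrite -dE (leq_pexp2l _ h3).
  by move: dm2; clear; lia.
have s2 : s ^+ 2 = d%:~R by [].
have int1 (n : int) := integers_int F n.
have dq : d = - q%:Z.
  case/dvdzP: (qd) => m dE.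
  have cop : coprimez q m.
    rewrite coprimezE prime_coprime //; apply/negP => qm.
    have := squarefree_logn_le1 (ltr0_neq0 d_lt0) d_sqfree hq.
    rewrite leqNgt -pfactor_dvdn ?absz_gt0 ?ltr0_neq0 // dE abszM mulnC.
    by rewrite expnS expn1 dvdn_mul.
  case/coprimezP: cop => -[u v] /= uv.
  (* The ideal is (q, s), the prime above q: s^2 = q m with m prime to q. *)
  apply: (@no_twist l q s m%:~R u%:~R 0 v%:~R) => //; try exact: int1.
  - exact: integers_s.
  - exact: integers0.
  - by rewrite s2 dE mulrC rmorphM.
  - rewrite mulr0 addr0 -[q%:R]/(q%:Z%:~R) -!rmorphM -rmorphD /=.
    by rewrite mulrC [m * v]mulrC uv.
exists q; split=> //.
have [//|q3] := eqVneq (q %% 4)%N (3 %% 4)%N.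
have q1 : (q %% 4 = 1)%N by move: q3 oq; clear; lia.
have q2 : (prime 2) by [].
exfalso; suff : d = - 2%:Z by move: dm2; clear; lia.
have [k qE] : exists k : int, q%:Z = 4 * k + 1.
  by exists (q %/ 4)%N%:Z; move: q1; clear; lia.
have iq (m n : int) : integers (m%:~R + n%:~R * s).
  by apply: integersD => //; apply: integersM => //; apply: integers_s.
(* The ideal is (2, 1 + s), the prime above 2: since d = -(4k + 1), (1 + s)^2 = 2 (s - 2k). *)
apply: (@no_twist l 2 (1 + s) ((- 2 * k)%:~R + s) (- k)%:~R 1 (-1)) => //.
- by have := iq 1 1; rewrite mul1r.
- by have := iq (- 2 * k) 1; rewrite mul1r.
- exact: integers1.
- exact: (int1 (-1)).
- rewrite sqrrD expr1n mul1r s2 dq qE !(rmorphN, rmorphD, rmorphM) /=; ring.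
- rewrite !(rmorphN, rmorphD, rmorphM) /=; ring.
Qed.

(** * Integers of the quadratic field *)

Lemma squarefree_int_coef (y : rat) (m : int) : d%:~R * y ^+ 2 = m%:~R ->
  exists n : int, y = n%:~R.
Proof.
move=> E; exists (numq y).
suff d1 : denq y = 1 by rewrite -[LHS]divq_num_den d1 divr1.
have dn0 : (denq y)%:~R != 0 :> rat by rewrite intr_eq0 denq_neq0.
have : (denq y ^+ 2 %| d * numq y ^+ 2)%Z.
  apply/dvdzP; exists m; apply: (@intr_inj rat).
  rewrite !(rmorphM, rmorphXn) /= -E -{2}[y]divq_num_den.
  by field.
rewrite Gauss_dvdzl; last first.
  rewrite coprimezE !abszX.
  by apply: coprimeXl; apply: coprimeXr; rewrite coprime_sym coprime_num_den.
by move=> /d_sqfree; rewrite unitzE; have := denq_gt0 y; clear; lia.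
Qed.

Lemma integers_half x : integers x -> exists t y n : int,
  [/\ x = quad (t%:~R / 2) (y%:~R / 2), t ^+ 2 - d * y ^+ 2 = 4 * n &
    quad_norm x = n%:~R].
Proof.
move=> ix; have [t ht] := integers_trace ix; have [n hn] := integers_norm ix.
have [|y hy] := @squarefree_int_coef (2 * quad_im x) (t ^+ 2 - 4 * n).
  by rewrite !(rmorphB, rmorphM, rmorphXn) /= -ht -hn /quad_norm; ring.
exists t, y, n; split=> //.
  rewrite -ht -hy -[LHS]quadE; congr quad; by field.
apply: (@intr_inj rat); rewrite !(rmorphB, rmorphM, rmorphXn) /= -ht -hn -hy /quad_norm.
by ring.
Qed.

Lemma integers_quad_half (t y n : int) : t ^+ 2 - d * y ^+ 2 = 4 * n ->
  integers (quad (t%:~R / 2) (y%:~R / 2)).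
Proof.
move=> E; set z := quad _ _.
exists ('X * ('X - t%:P) + n%:P).
  rewrite monicE lead_coefDl; first by rewrite lead_coefM lead_coefX lead_coefXsubC mul1r.
  rewrite mulrC size_mulX ?polyXsubC_eq0 // size_XsubC size_polyC; by case: eqP.
rewrite rmorphD rmorphM rmorphB /= !map_polyX !map_polyC /= rootE !hornerE.
have -> : t%:~R = quad t%:~R 0 :> F by rewrite quad_int.
have -> : n%:~R = quad n%:~R 0 :> F by rewrite quad_int.
rewrite /z quadN quadD quadM quadD; apply/eqP; apply: etrans (quad_int 0).
congr quad; last by field.
have -> : n%:~R = (t%:~R ^+ 2 - d%:~R * y%:~R ^+ 2) / 4 :> rat.
  by rewrite -!(rmorphB, rmorphM, rmorphXn) /= E rmorphM /=; field.
by rewrite /=; field.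
Qed.

(** * Square roots in an unramified extension of the quadratic field *)

Variable q : nat.
Hypotheses (q_prime : prime q) (q_mod4 : q = 3 %[mod 4]) (d_eq : d = - q%:Z).
Variable L : fieldExtType F.
Hypothesis unramL : unramified_finite L.
Implicit Types (x : F) (P : set L) (r : nat) (b : L).

Lemma int_alg (n : int) : n%:~R = (n%:~R : F)%:A :> L.
Proof. by rewrite -(rmorph_int (in_alg L)). Qed.

Lemma integers_algE x : integers (x%:A : L) <-> integers x.
Proof. exact: (integers_rmorph (in_alg L)). Qed.

Lemma norm_alg x (n : int) : quad_norm x = n%:~R ->
  x%:A * (quad_conj x)%:A = n%:~R :> L.
Proof.
move=> hn; rewrite -!in_algE -rmorphM mul_conj hn -quad_rat quad_int /=.
by rewrite int_alg.
Qed.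

Lemma trace_alg x (t : int) : 2 * quad_re x = t%:~R ->
  x%:A + (quad_conj x)%:A = t%:~R :> L.
Proof.
by move=> ht; rewrite -scalerDl add_conj ht -quad_rat quad_int int_alg.
Qed.

Lemma maximal_ideal_norm P x (n : int) : maximal_ideal P -> integers x ->
  quad_norm x = n%:~R -> P x%:A -> P n%:~R.
Proof.
move=> [[_ [_ _ PM]] _ _] ix hn Px; rewrite -(norm_alg hn) mulrC; apply: PM => //.
by apply/integers_algE; apply: integers_conj.
Qed.

Lemma integers_int_inv (n : int) (a : L) : integers a -> n%:~R * a = 1 -> `|n|%N = 1%N.
Proof.
move=> ia na; have nL : n%:~R != 0 :> L.
  by apply/eqP => n0; move: na; rewrite n0 mul0r => /eqP; rewrite eq_sym oner_eq0.
have nQ : n%:~R != 0 :> rat.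
  by apply: contraNneq nL => /eqP; rewrite intr_eq0 => /eqP ->.
have aE : a = ((n%:~R : rat)^-1%:A : F)%:A.
  apply: (mulfI nL); rewrite na int_alg -quad_int quad_rat -!in_algE -!rmorphM.
  by rewrite mulfV // !rmorph1.
move: ia; rewrite aE => /integers_algE/integers_alg [k /eqP].
rewrite eq_sym -(inj_eq (mulfI nQ)) mulfV // => /eqP h.
have nk : n * k = 1 by apply: (@intr_inj rat); rewrite rmorphM.
have : n \is a GRing.unit by apply/unitrP; exists k; rewrite mulrC nk.
by rewrite unitzE => /eqP.
Qed.

(** This expresses that r does not ramify in F. Writing x = (t + y s) / 2, the prime r divides the
    trace t and the norm of x, hence y, since r does not divide d. *)
Lemma prime_divides_quad P r x : prime r -> r != q -> integers x ->
  maximal_ideal P -> P r%:R -> P x%:A -> P (quad_conj x)%:A ->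
  exists2 z, integers z & x = r%:R * z.
Proof.
move=> hr rq ix mP Pr Px Px'; have [t [y [n [xE E hn]]]] := integers_half ix.
have [[_ [_ PD _]] _ _] := mP.
have r0 : r%:Z != 0 by case: (r) hr.
have rt : (r %| t)%Z.
  apply: (maximal_ideal_int mP hr Pr); rewrite -(@trace_alg x t); first exact: PD.
  by rewrite xE quad_reE mulrC divfK.
have rn : (r %| n)%Z.
  by apply: (maximal_ideal_int mP hr Pr); apply: maximal_ideal_norm hn Px.
have rd : ~~ (r %| d)%Z by rewrite d_eq dvdzE abszN /= dvdn_prime2.
have ry : (r %| y)%Z.
  rewrite -prime_dvdzX //.
  have : (r %| d * y ^+ 2)%Z.
    have -> : d * y ^+ 2 = t * t - n * 4 by move: E; clear; lia.
    by rewrite rpredB // dvdz_mulr.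
  by rewrite prime_dvdzM // (negbTE rd).
case/dvdzP: rt => t' tE; case/dvdzP: ry => y' yE.
have rrn : (r%:Z ^+ 2 %| n)%Z.
  have E' : 4 * n = r%:Z ^+ 2 * (t' ^+ 2 - d * y' ^+ 2) by rewrite -E tE yE; ring.
  (* For r = 2 the factor 4 absorbs r^2. Instead n = t'^2 + q y'^2 is even, so t' and y' have the
     same parity, and 4 | n because q = 3 mod 4. *)
  have [r2|r2] := eqVneq r 2%N.
    have [k qE] : exists k : int, q%:Z = 4 * k + 3.
      by exists (q %/ 4)%N%:Z; move: q_mod4; clear; lia.
    have nE : n = t' ^+ 2 - d * y' ^+ 2 by move: E'; rewrite r2; clear; lia.
    move: rn; rewrite nE r2 d_eq qE.
    have [[i ->]|[i ->]] := even_or_sqr8 t'; have [[j ->]|[j ->]] := even_or_sqr8 y';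
      clear; lia.
  have : (r%:Z ^+ 2 %| 4 * n)%Z by rewrite E' dvdz_mulr.
  rewrite Gauss_dvdzr // coprimezE abszX coprimeXl // prime_coprime //.
  by rewrite -[absz 4]/(2 * 2)%N Euclid_dvdM // orbb dvdn_prime2.
case/dvdzP: rrn => n' nE.
exists (quad (t'%:~R / 2) (y'%:~R / 2)).
  apply: (@integers_quad_half _ _ n').
  apply: (mulfI (expf_neq0 2 r0)).
  transitivity (4 * n); last by rewrite nE; ring.
  by rewrite -E tE yE; ring.
rewrite xE -[r%:R]/(r%:Z%:~R) -quad_int quadM tE yE !rmorphM /=; congr quad; ring.
Qed.

(** Locally at P the prime r generates P cap F: either the conjugate of x lies outside P and
    multiplies x into its norm, a multiple of r, or both lie in P and r divides x. *)
Lemma uniformizer_unramified P r x : prime r -> r != q -> integers x ->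
  maximal_ideal P -> P r%:R -> P x%:A ->
  exists c z : F, [/\ integers c, ~ P c%:A, integers z & c * x = r%:R * z].
Proof.
move=> hr rq ix mP Pr Px; have [iP P1 _] := mP.
have [Px'|Px'] := pselect (P (quad_conj x)%:A).
  have [z iz xE] := prime_divides_quad hr rq ix mP Pr Px Px'.
  exists 1, z; split=> //; [exact: integers1 | by rewrite scale1r | by rewrite mul1r].
have [n hn] := integers_norm ix.
have /dvdzP [m nE] : (r %| n)%Z.
  by apply: (maximal_ideal_int mP hr Pr); apply: maximal_ideal_norm hn Px.
exists (quad_conj x), m%:~R; split=> //; [exact: integers_conj | exact: integers_int |].
rewrite mulrC mul_conj hn -quad_rat quad_int nE rmorphM /= mulrC; by [].
Qed.

(** If r does not divide N x, any P above r will do. Otherwise P is taken above r and the conjugate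
    of x: these generate a proper ideal, as a relation 1 = r a + (conj x) c would make x / r
    integral. *)
Lemma maximal_ideal_avoiding r x : prime r -> r != q -> integers x ->
  ~ (exists2 z, integers z & x = r%:R * z) ->
  exists P, [/\ maximal_ideal P, P r%:R & ~ P x%:A].
Proof.
move=> hr rq ix nx; have [n hn] := integers_norm ix.
have r0 : r%:R != 0 :> F.
  by rewrite -[r%:R]/(r%:Z%:~R) quad_int_eq0; case: (r) hr.
have rA : r%:R = (r%:R : F)%:A :> L by rewrite -[r%:R]/(r%:Z%:~R) int_alg.
have irL : integers (r%:R : L) by exact: (integers_int L r).
have rL : r%:R != 0 :> L by rewrite rA -in_algE fmorph_eq0.
have [/dvdzP [m nE]|rn] := boolP (r %| n)%Z; last first.
  have [||a c ia ic E|P [mP Pr _]] := @exists_maximal_ideal2 L r%:R 0 => //.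
  - exact: integers0.
  - have := @integers_int_inv r a ia; rewrite -[r%:~R]/(r%:R).
    by move: E; rewrite mul0r addr0 => E /(_ E) /= r1; move: hr; rewrite r1.
  - exists P; split=> // Px; case/negP: rn.
    by apply: (maximal_ideal_int mP hr Pr); apply: maximal_ideal_norm hn Px.
have ic : integers (quad_conj x) by exact: integers_conj.
have [||a c ia ic' E|P [mP Pr Px']] :=
  @exists_maximal_ideal2 L r%:R (quad_conj x)%:A => //.
- exact/integers_algE.
- apply: nx; exists (x / r%:R); last by rewrite mulrC divfK.
  apply/integers_algE.
  suff -> : (x / r%:R)%:A = x%:A * a + m%:~R * c.
    apply: integersD; apply: integersM => //; first exact/integers_algE.
    exact: integers_int.
  apply: (mulfI rL).
  transitivity (x%:A : L); first by rewrite rA -!in_algE -rmorphM mulrC divfK.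
  transitivity (x%:A * (r%:R * a + (quad_conj x)%:A * c)); first by rewrite E mulr1.
  rewrite mulrDr [x%:A * (_ * c)]mulrA (norm_alg hn) nE rmorphM /=.
  by rewrite -[r%:~R]/(r%:R); ring.
- exists P; split=> // Px; apply: nx.
  exact: (prime_divides_quad hr rq ix mP Pr Px Px').
Qed.

(** At a P above r that avoids x, c = b / r^k has square r times a unit, so c is an element of P
    whose square generates P cap F locally. *)
Lemma odd_valuation_ramified r (k : nat) (m m' : int) x b : prime r -> r != q ->
  integers x -> x != 0 -> ~ (exists2 z, integers z & x = r%:R * z) ->
  m = r%:Z ^+ k.*2.+1 * m' -> ~~ (r %| m')%Z -> b ^+ 2 = (m%:~R * x)%:A -> False.
Proof.
move=> hr rq ix x0 nx mE rm bE.
have [P [mP Pr Px]] := maximal_ideal_avoiding hr rq ix nx.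
have r0 : r%:R != 0 :> F.
  by rewrite -[r%:R]/(r%:Z%:~R) quad_int_eq0; case: (r) hr.
have rA : r%:R = (r%:R : F)%:A :> L by rewrite -[r%:R]/(r%:Z%:~R) int_alg.
have rL : r%:R != 0 :> L by rewrite rA -in_algE fmorph_eq0.
have ixL : integers (x%:A : L) by apply/integers_algE.
have imL : integers (m'%:~R : L) by exact: integers_int.
have Pm : ~ P m'%:~R by move=> /(maximal_ideal_int mP hr Pr); apply/negP.
pose c := b / r%:R ^+ k.
have cE : c ^+ 2 = r%:R * (m'%:~R * x%:A).
  rewrite /c expr_div_n bE mE -in_algE !(rmorphM, rmorphXn, rmorph_int) /=.
  rewrite -[r%:~R]/(r%:R) -exprM muln2 exprS; field.
  exact: expf_neq0.
have [[_ [_ _ PM]] P1 _] := mP.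
have ic : integers c.
  apply: integers_sqrt; rewrite cE; apply: integersM; last exact: integersM.
  exact: (integers_int L r).
have Pc : P c.
  by apply: maximal_ideal_sqrt => //; rewrite cE mulrC; apply: PM => //; apply: integersM.
have Pmx : ~ P (m'%:~R * x%:A) by apply: maximal_idealM.
have c0 : c != 0.
  rewrite -sqrf_eq0 cE mulf_neq0 //; apply/eqP => h; apply: Pmx.
  by rewrite h; have [[_ []]] := mP.
apply: (square_uniformizer_ramified unramL mP Pc c0) => z iz Pz.
have [e [w [ie Pe iw E]]] := uniformizer_unramified hr rq iz mP Pr Pz.
have ieL : integers (e%:A : L) by apply/integers_algE.
exists (e%:A * (m'%:~R * x%:A)), w%:A; split.
- by apply: integersM => //; apply: integersM.
- by apply: maximal_idealM => //; apply: integersM.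
- exact/integers_algE.
- rewrite cE; transitivity ((m'%:~R * x%:A) * (e%:A * z%:A) : L); first by ring.
  rewrite -!in_algE -[in_alg L e * _]rmorphM E rmorphM /= -rA; ring.
Qed.

(** Each division by r divides the norm by r^2, so the extraction terminates. *)
Lemma quad_pfactor r x : prime r -> integers x -> x != 0 ->
  exists (k : nat) (z : F), [/\ integers z, x = r%:R ^+ k * z &
    ~ (exists2 y, integers y & z = r%:R * y)].
Proof.
move=> hr; have [n hn] : exists n : nat,
    forall k : int, quad_norm x = k%:~R -> (`|k| < n)%N.
  have [E|nE] := pselect (exists k : int, quad_norm x = k%:~R); last first.
    by exists 0%N => k hk; case: nE; exists k.
  have [k hk] := E; exists `|k|.+1 => k'; rewrite hk => /intr_inj ->; exact: leqnn.
elim: n x hn => [|n IH] x hn ix x0.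
  by have [k hk] := integers_norm ix; have := hn k hk.
have [[z iz xE]|h] := pselect (exists2 y, integers y & x = r%:R * y); last first.
  by exists 0%N, x; split=> //; rewrite expr0 mul1r.
have z0 : z != 0 by apply: contraNneq x0 => z0; rewrite xE z0 mulr0.
have [m hm] := integers_norm iz.
have [|//|//|k [y [iy zE ny]]] := IH z; last first.
  by exists k.+1, y; split=> //; rewrite xE zE exprS mulrA.
move=> m' hm'; have {hm'} <- : m = m' by apply: (@intr_inj rat); rewrite -hm -hm'.
have : quad_norm x = (r%:Z ^+ 2 * m)%:~R.
  rewrite xE quad_normM hm -[r%:R]/(r%:Z%:~R) -quad_int quad_normE.
  by rewrite expr0n mulr0 subr0 rmorphM rmorphXn.
move=> /hn; rewrite abszM abszX /=.
have m0 : (0 < `|m|)%N.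
  by rewrite absz_gt0 -(intr_eq0 rat) -hm quad_norm_eq0.
have r2 : (1 < r ^ 2)%N by rewrite -(exp1n 2) ltn_exp2r // prime_gt1.
by rewrite ltnS; apply: leq_trans; rewrite mulnC; apply: ltn_Pmulr.
Qed.

Lemma even_valuation r (m : int) x b : prime r -> r != q -> m != 0 ->
  integers x -> x != 0 -> ~ (exists2 z, integers z & x = r%:R * z) ->
  b ^+ 2 = (m%:~R * x)%:A -> ~~ odd (logn r `|m|).
Proof.
move=> hr rq m0 ix x0 nx bE; apply/negP => om.
have [m' mE rm] := int_pfactor hr m0.
apply: (odd_valuation_ramified (k := (logn r `|m|)./2) hr rq ix x0 nx _ rm bE).
by rewrite {1}mE -[in LHS](odd_double_half (logn r `|m|)) om.
Qed.

(* With x = r^k z, both r^k z and r^k (N z) (conj z) = (conj z)^2 x are squares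
   in L, so both k and k + v_r(N z) are even. *)
Lemma even_norm_valuation r x b (n : int) : prime r -> r != q ->
  integers x -> x != 0 -> quad_norm x = n%:~R -> b ^+ 2 = x%:A ->
  ~~ odd (logn r `|n|).
Proof.
move=> hr rq ix x0 hn bE.
have [k [z [iz xE nz]]] := quad_pfactor hr ix x0.
have z0 : z != 0 by apply: contraNneq x0 => z0; rewrite xE z0 mulr0.
have [m hm] := integers_norm iz.
have m0 : m != 0 by rewrite -(intr_eq0 rat) -hm quad_norm_eq0.
have r0 : r%:Z != 0 by case: (r) hr.
have rk0 : r%:Z ^+ k != 0 by rewrite expf_neq0.
have rkE : (r%:Z ^+ k)%:~R = r%:R ^+ k :> F by rewrite rmorphXn.
have hE : `|n|%N = (`|r%:Z ^+ k| ^ 2 * `|m|)%N.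
  have -> : n = (r%:Z ^+ k) ^+ 2 * m.
    apply: (@intr_inj rat); rewrite -hn xE quad_normM hm rmorphM.
    by rewrite -rkE -quad_int quad_normE expr0n mulr0 subr0 rmorphXn.
  by rewrite abszM abszX.
have izc := integers_conj iz.
have zc0 : quad_conj z != 0.
  apply: contraNneq z0 => h; rewrite -quad_norm_eq0.
  by rewrite -(inj_eq (fmorph_inj (in_alg F))) /= -mul_conj h mulr0 scale0r.
have nzc : ~ (exists2 y, integers y & quad_conj z = r%:R * y).
  move=> [y iy zE]; apply: nz; exists (quad_conj y); first exact: integers_conj.
  have conjK w : quad_conj (quad_conj w) = w.
    by rewrite -{1}(quadE w) !quad_conjE opprK quadE.
  rewrite -[LHS]conjK zE -(quadE y) -[r%:R]/(r%:Z%:~R) -quad_int quadM !quad_conjE quadM.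
  congr quad; ring.
have bE' : (b * (quad_conj z)%:A) ^+ 2 = ((r%:Z ^+ k * m)%:~R * quad_conj z)%:A.
  have key : (r%:Z ^+ k * m)%:~R * quad_conj z = x * quad_conj z ^+ 2.
    have mzE : m%:~R = z * quad_conj z by rewrite mul_conj hm -quad_rat quad_int.
    by rewrite rmorphM /= mzE rkE xE; ring.
  by rewrite key exprMn bE -!in_algE [in RHS]rmorphM rmorphXn.
have := even_valuation hr rq (mulf_neq0 rk0 m0) izc zc0 nzc bE'.
have m0' : (0 < `|m|)%N by rewrite absz_gt0.
have rk0' : (0 < `|r%:Z ^+ k|)%N by rewrite absz_gt0.
rewrite hE abszM !lognM ?expn_gt0 ?rk0' // ?lognX => h.
have := even_valuation hr rq rk0 iz z0 nz _; rewrite rkE -xE => /(_ b bE).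
by move: h; rewrite !oddD /=; do 2 case: odd.
Qed.

(** If y = (t + u s) / 2 then q | N y gives t = q t' = - s^2 t', so 2y = s (u - t' s); the factor 2
    keeps the cofactor in Z[s]. *)
Lemma divisible_by_s y (n : int) : integers y -> quad_norm y = n%:~R ->
  (q %| n)%Z -> exists2 z, integers z & 2 * y = s * z.
Proof.
move=> iy hn qn; have [t [u [n' [yE E hn']]]] := integers_half iy.
have nn : n' = n by apply: (@intr_inj rat); rewrite -hn -hn'.
rewrite nn d_eq in E.
have /dvdzP [t' tE] : (q %| t)%Z.
  rewrite -prime_dvdzX //.
  have -> : t ^+ 2 = n * 4 - q%:Z * u ^+ 2 by move: E; clear; lia.
  by rewrite rpredB // dvdz_mulr.
exists (quad u%:~R (- t')%:~R); first exact: integers_quad_int.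
have -> : 2 = quad 2%:~R 0 :> F by rewrite quad_int.
have sE : s = quad 0 1 by rewrite quad_s.
rewrite [in RHS]sE yE !quadM d_eq tE !(rmorphM, rmorphN) /=; congr quad; by field.
Qed.

Lemma s_neq0 : s != 0.
Proof.
by rewrite -sqrf_eq0 sqr_s quad_int_eq0 lt_eqF.
Qed.

Lemma q_odd : odd q.
Proof. by move: q_mod4; clear; lia. Qed.

Lemma exists_maximal_s : exists P, [/\ maximal_ideal P, P s%:A & P q%:R].
Proof.
have isL : integers (s%:A : L) by apply/integers_algE; apply: integers_s.
have ssE : s%:A * s%:A = (- q%:Z)%:~R :> L.
  by rewrite -!in_algE -rmorphM -expr2 sqr_s d_eq rmorph_int.
have [||a b ia ib E|P [mP Ps _]] := @exists_maximal_ideal2 L s%:A 0 => //.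
- exact: integers0.
- have := @integers_int_inv (- q%:Z) (a * a) (integersM ia ia).
  move: E; rewrite mul0r addr0 => E; rewrite -ssE mulrACA E mulr1 => /(_ erefl).
  by have := prime_gt1 q_prime; clear; lia.
exists P; split=> //; have [[_ [_ _ PM]] _ _] := mP.
have -> : q%:R = (- s%:A) * s%:A :> L.
  by rewrite mulNr ssE rmorphN opprK.
by apply: PM => //; apply: integersN.
Qed.

(* Over q the uniformizer is s: when x = s z / 2 with z a unit at P, (2b)^2 is
   s times a unit; otherwise descend to 4x / s^2. *)
Lemma even_norm_valuation_q x b (n : int) : integers x -> x != 0 ->
  quad_norm x = n%:~R -> b ^+ 2 = x%:A -> ~~ odd (logn q `|n|).
Proof.
have [k] := ubnP (logn q `|n|); elim: k x b n => // k IH x b n lt_k ix x0 hn bE.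
have n0 : n != 0 by rewrite -(intr_eq0 rat) -hn quad_norm_eq0.
have n0' : (0 < `|n|)%N by rewrite absz_gt0.
have q0 : (0 < q)%N by apply: prime_gt0.
apply/negP => on.
have qn : (q %| n)%Z.
  rewrite dvdzE -[absz q]expn1 pfactor_dvdn //.
  by case: (logn _ _) on.
have [z iz xz] := divisible_by_s ix hn qn.
have [m hm] := integers_norm iz.
have n2 (j : int) : quad_norm (j%:~R : F) = (j ^+ 2)%:~R.
  by rewrite -quad_int quad_normE expr0n mulr0 subr0 rmorphXn.
have n22 : quad_norm 2 = 4%:~R by rewrite -[2]/(2%:~R) n2.
have ns : quad_norm s = q%:Z%:~R.
  by rewrite -[in LHS]quad_s quad_normE d_eq rmorphN expr0n expr1n mulr1 sub0r opprK.
have mE : 4 * n = q%:Z * m.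
  apply: (@intr_inj rat); have := congr1 quad_norm xz.
  by rewrite !quad_normM n22 hn ns hm -!rmorphM.
have two0 : 2 != 0 :> F.
  by rewrite -[2]/(2%:~R) -quad_norm_eq0 n2 intr_eq0.
have z0 : z != 0.
  apply: contraNneq x0 => z0; move: xz; rewrite z0 mulr0 => /eqP.
  by rewrite mulf_eq0 (negbTE two0).
have [qm|qm] := boolP (q %| m)%Z.
  have [w iw zw] := divisible_by_s iz hm qm.
  have [m' hm'] := integers_norm iw.
  have m'E : 4 * m = q%:Z * m'.
    apply: (@intr_inj rat); have := congr1 quad_norm zw.
    by rewrite !quad_normM n22 hm ns hm' -!rmorphM.
  have w0 : w != 0.
    apply: contraNneq z0 => w0; move: zw; rewrite w0 mulr0 => /eqP.
    by rewrite mulf_eq0 (negbTE two0).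
  have m'0 : m' != 0 by rewrite -(intr_eq0 rat) -hm' quad_norm_eq0.
  have m'0' : (0 < `|m'|)%N by rewrite absz_gt0.
  have EE : (`|n| * 2 ^ 4 = q ^ 2 * `|m'|)%N.
    have : n * 2 ^+ 4 = q%:Z ^+ 2 * m'.
      transitivity (4 * (4 * n)); first by ring.
      by rewrite mE mulrCA m'E; ring.
    by move=> /(congr1 absz); rewrite !abszM.
  have l2 : logn q (2 ^ 4) = 0%N.
    rewrite lognX logn_coprime // prime_coprime //.
    by rewrite dvdn_prime2 //; apply: contraTneq q_odd => ->.
  have lE : logn q `|n| = (logn q `|m'|).+2.
    have := congr1 (logn q) EE; rewrite lognM // l2 addn0 lognM // ?expn_gt0 ?q0 //.
    by rewrite pfactorK.
  have lt_k' : (logn q `|m'| < k)%N by move: lt_k; rewrite lE ltnS => /ltnW.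
  suff bw : (2 * b / s%:A) ^+ 2 = w%:A.
    have := IH w _ m' lt_k' iw w0 hm' bw.
    by move: on; rewrite lE /= negbK => ->.
  have sL : s%:A != 0 :> L by rewrite -in_algE fmorph_eq0 s_neq0.
  rewrite expr_div_n exprMn bE; apply: (mulIf (expf_neq0 2 sL)).
  rewrite divfK ?expf_neq0 //.
  have -> : 2 = (2 : F)%:A :> L by rewrite -[2]/(2%:~R) int_alg.
  rewrite -!in_algE -!rmorphXn -!rmorphM /=; congr (_%:A).
  transitivity (2 * (2 * x)); first by ring.
  by rewrite xz mulrCA zw; ring.
have [P [mP Ps Pq]] := exists_maximal_s.
have [[_ [_ _ PM]] P1 _] := mP.
have Pz : ~ P z%:A.
  move=> Pz; case/negP: qm; apply: (maximal_ideal_int mP q_prime Pq).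
  exact: maximal_ideal_norm hm Pz.
have P2 : ~ P 2%:R.
  rewrite -[2%:R]/(2%:~R) => /(maximal_ideal_int mP q_prime Pq).
  by rewrite dvdzE /= dvdn_prime2 // => /eqP q2; move: q_odd; rewrite q2.
have i2 : integers (2%:R : L) by exact: (integers_int L 2).
have twoA : 2 = (2 : F)%:A :> L by rewrite -[2]/(2%:~R) int_alg.
have izL : integers (z%:A : L) by apply/integers_algE.
have isL : integers (s%:A : L) by apply/integers_algE; apply: integers_s.
have ib : integers b by apply: integers_sqrt; rewrite bE; apply/integers_algE.
have bbE : (2 * b) ^+ 2 = 2 * z%:A * s%:A.
  rewrite exprMn bE twoA -!in_algE -rmorphXn -!rmorphM /=; congr (_%:A).
  by rewrite expr2 -mulrA xz; ring.
have Pb : P (2 * b).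
  apply: maximal_ideal_sqrt => //; first exact: integersM.
  by rewrite bbE; apply: PM => //; apply: integersM.
have b0 : 2 * b != 0.
  apply: mulf_neq0; first by rewrite twoA -in_algE fmorph_eq0.
  by rewrite -sqrf_eq0 bE -in_algE fmorph_eq0.
apply: (square_uniformizer_ramified unramL mP Pb b0) => y iy Py.
have [ny hny] := integers_norm iy.
have qny : (q %| ny)%Z.
  by apply: (maximal_ideal_int mP q_prime Pq); apply: maximal_ideal_norm hny Py.
have [y' iy' yE] := divisible_by_s iy hny qny.
exists (2 * (2 * z%:A)), y'%:A; split.
- by do 2!apply: integersM => //.
- by apply: maximal_idealM => //; [apply: integersM | apply: maximal_idealM].
- exact/integers_algE.
- rewrite bbE; transitivity (2 * z%:A * ((2 : F) * y)%:A : L); last first.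
    by rewrite yE -!in_algE rmorphM /=; ring.
  by rewrite twoA -!in_algE rmorphM /=; ring.
Qed.

Lemma norm_square x b : integers x -> x != 0 -> b ^+ 2 = x%:A ->
  exists k : int, quad_norm x = (k ^+ 2)%:~R.
Proof.
move=> ix x0 bE; have [n hn] := integers_norm ix.
have n0 : 0 < n.
  by rewrite -(ltr0z rat) -hn lt_neqAle quad_norm_ge0 andbT eq_sym quad_norm_eq0.
have [||k kE] := @square_of_even_logn `|n|.
- by move: n0; clear; lia.
- move=> r hr; have [->|rq] := eqVneq r q.
    exact: even_norm_valuation_q hn bE.
  exact: even_norm_valuation hn bE.
exists k; rewrite hn; congr (_%:~R).
by rewrite -[n]gtz0_abs // kE -mulnn PoszM expr2.
Qed.

(* Hilbert 90: if N x = k^2 then (x + k)^2 = x (tr x + 2k). *)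
Lemma square_norm_rational x (k : int) : x != 0 -> integers x ->
  quad_norm x = (k ^+ 2)%:~R ->
  exists (t : int) (c : F), t != 0 /\ x * t%:~R = c ^+ 2.
Proof.
move=> x0 ix hk; have [t ht] := integers_trace ix.
have tE : x + quad_conj x = t%:~R by rewrite add_conj ht -quad_rat quad_int.
have kE : x * quad_conj x = k%:~R ^+ 2.
  by rewrite mul_conj hk -quad_rat quad_int rmorphXn.
have E : (x + k%:~R) ^+ 2 = x * (t + 2 * k)%:~R.
  rewrite rmorphD rmorphM /= -tE.
  transitivity (x ^+ 2 + 2 * k%:~R * x + k%:~R ^+ 2); first by ring.
  by rewrite -kE; ring.
have [t0|t0] := eqVneq (t + 2 * k) 0; last by exists (t + 2 * k), (x + k%:~R).
have xE : x = - k%:~R.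
  by apply/eqP; rewrite -addr_eq0 -sqrf_eq0 E t0 mulr0.
exists (- k), x; split; last by rewrite {1}xE rmorphN xE; ring.
by apply: contraNneq x0 => k0; rewrite xE -rmorphN k0.
Qed.

Lemma one_not_divisible r : prime r -> ~ (exists2 z : F, integers z & 1 = r%:R * z).
Proof.
move=> hr [z iz zE]; have : integers (z%:A : L) by apply/integers_algE.
move=> /(@integers_int_inv r) h; have : `|r%:Z|%N = 1%N.
  by apply: h; rewrite int_alg -in_algE -rmorphM -[r%:~R]/(r%:R) -zE rmorph1.
by move=> /= r1; move: hr; rewrite r1.
Qed.

(** |t| is k^2 or q k^2, and q k^2 = - (s k)^2. *)
Lemma rational_sqrt (t : int) b : t != 0 -> b ^+ 2 = t%:~R ->
  exists c : F, c ^+ 2 = t%:~R \/ c ^+ 2 = - t%:~R.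
Proof.
move=> t0 bE; have t0' : (0 < `|t|)%N by rewrite absz_gt0.
have ev r : prime r -> r != q -> ~~ odd (logn r `|t|).
  move=> hr rq.
  apply: (even_valuation (b := b) hr rq t0 (integers1 F) (oner_neq0 F)).
    exact: one_not_divisible.
  by rewrite bE mulr1 int_alg.
have sgn (c : F) : c ^+ 2 = `|t|%:~R \/ c ^+ 2 = - `|t|%:~R ->
    exists c : F, c ^+ 2 = t%:~R \/ c ^+ 2 = - t%:~R.
  move=> h; exists c; case: (ger0P t) h => _; rewrite ?rmorphN ?opprK; tauto.
have [oq|eq_] := boolP (odd (logn q `|t|)); last first.
  have [//|k kE] := @square_of_even_logn `|t| t0'.
    by move=> r hr; have [->|rq] := eqVneq r q; [exact: eq_ | exact: ev].
  apply: (sgn k%:~R); left; rewrite -abszE kE -mulnn PoszM rmorphM; by [].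
have q0 : (0 < q)%N by apply: prime_gt0.
have /dvdnP [m mE] : (q %| `|t|)%N.
  by rewrite -[q in (q %| _)%N]expn1 pfactor_dvdn //; case: (logn _ _) oq.
have m0 : (0 < m)%N by move: t0'; rewrite mE muln_gt0 => /andP [].
have [//|k kE] := @square_of_even_logn m m0.
  move=> r hr; have [rq|rq] := eqVneq r q.
    by move: oq; rewrite rq mE lognM // oddD [logn q q]logn_prime // eqxx addbT.
  have := ev r hr rq; rewrite mE lognM // oddD.
  by rewrite [logn r q]logn_prime // (negbTE rq) addbF.
apply: (sgn (s * k%:~R)); right.
rewrite exprMn sqr_s d_eq -abszE mE kE -mulnn !PoszM !rmorphN !rmorphM /=; ring.
Qed.

(* If i is in L, then (1 + i)^2 = 2i ramifies over 2. *)
Lemma no_sqrt_minus_one b : b ^+ 2 <> -1.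
Proof.
move=> bE; have i1 := integers1 L.
have ib : integers b by apply: integers_sqrt; rewrite bE; apply: integersN.
have i1b : integers (1 + b) by apply: integersD.
have [||a c ia ic E|P [mP Pb _]] := @exists_maximal_ideal2 L (1 + b) 0 => //.
- exact: integers0.
- move: E; rewrite mul0r addr0 => E.
  (* Since (1 + b)^4 = -4, an integral inverse of 1 + b would make -4 a unit. *)
  have ia2 : integers (a ^+ 2) by apply: integersX.
  have /(@integers_int_inv (-4)) h : integers (a ^+ 2 * a ^+ 2) by apply: integersM.
  suff /h : (-4)%:~R * (a ^+ 2 * a ^+ 2) = 1 :> L by [].
  have -> : (-4)%:~R = ((1 + b) ^+ 2) ^+ 2 :> L.
    have -> : (1 + b) ^+ 2 = 2 * b by rewrite sqrrD bE expr1n; ring.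
    by rewrite exprMn bE rmorphN /=; ring.
  transitivity (((1 + b) * a) ^+ 2 * ((1 + b) * a) ^+ 2); first by ring.
  by rewrite E; ring.
have [[_ [_ _ PM]] P1 _] := mP.
have P2 : P 2%:R.
  have -> : 2%:R = (1 - b) * (1 + b) :> L.
    by transitivity (1 - b ^+ 2); [rewrite bE; ring | ring].
  by apply: PM => //; apply: integersB.
have b0 : 1 + b != 0.
  apply/eqP => h; move: (bE); have -> : b = -1 by apply/eqP; rewrite -addr_eq0 addrC h.
  rewrite sqrrN expr1n => /eqP; rewrite -addr_eq0 => /eqP h2.
  have /eqP : (2 : F)%:A == 0 :> L.
    by rewrite -[2]/(2%:~R) -int_alg; apply/eqP; rewrite -h2; ring.
  by rewrite -in_algE => /eqP; rewrite fmorph_eq0 -[2]/(2%:~R) quad_int_eq0.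
have q2 : 2%N != q by apply: contraTneq q_odd => <-.
apply: (square_uniformizer_ramified unramL mP Pb b0) => x ix Px.
have [c [z [ic Pc iz E]]] := uniformizer_unramified (isT : prime 2) q2 ix mP P2 Px.
(* (1 + b)^2 = 2b gives 2 = - b (1 + b)^2, so 2 is locally the square of the uniformizer up to a
   unit. *)
exists c%:A, (- b * z%:A); split=> //.
- exact/integers_algE.
- by apply: integersM; [apply: integersN | apply/integers_algE].
- rewrite -!in_algE -rmorphM E rmorphM rmorph_nat /=.
  transitivity ((- 2 * b ^+ 2) * z%:A - (b ^+ 2 + 1) * b * z%:A); last by ring.
  by rewrite bE; ring.
Qed.

Lemma sqrt_descends x b : b ^+ 2 = x%:A -> exists c : F, c ^+ 2 = x.
Proof.
have [->|x0] := eqVneq x 0; first by exists 0; rewrite expr0n.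
move=> bE; pose D := denq (quad_re x) * denq (quad_im x).
have D0 : D != 0 by rewrite mulf_neq0 // denq_neq0.
have iDx : integers (D%:~R * x).
  rewrite -(quadE x) -[D%:~R]quad_int quadM.
  rewrite (_ : _ + _ = (numq (quad_re x) * denq (quad_im x))%:~R); last first.
    rewrite /D -{2}[quad_re x]divq_num_den !rmorphM /=; field.
    by rewrite intr_eq0 denq_neq0.
  rewrite (_ : _ + 0 * _ = (numq (quad_im x) * denq (quad_re x))%:~R); last first.
    rewrite /D -{2}[quad_im x]divq_num_den !rmorphM /=; field.
    by rewrite intr_eq0 denq_neq0.
  exact: integers_quad_int.
have iD (n : int) : integers (n%:~R : F) by exact: integers_int.
have DF n : n != 0 -> n%:~R != 0 :> F.
  by rewrite quad_int_eq0.
(* The denominator enters twice so that y and x differ by a square. *)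
pose y := D%:~R * (D%:~R * x).
have iy : integers y by apply: integersM.
have y0 : y != 0 by rewrite !mulf_neq0 ?DF.
have yE : (D%:~R%:A * b) ^+ 2 = y%:A.
  by rewrite exprMn bE -!in_algE -rmorphXn -rmorphM /=; congr (_%:A); rewrite /y; ring.
have [k hk] := norm_square iy y0 yE.
have [t [c [t0 tc]]] := square_norm_rational y0 iy hk.
have yL : y%:A != 0 :> L by rewrite -in_algE fmorph_eq0.
have bt : (c%:A / (D%:~R%:A * b)) ^+ 2 = t%:~R :> L.
  rewrite expr_div_n yE -[_%:A ^+ 2]/(in_alg L c ^+ 2) -rmorphXn -tc rmorphM /=.
  by rewrite -int_alg mulrAC mulfV ?mul1r.
have tF := DF t t0.
have [e [eE|eE]] := rational_sqrt t0 bt.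
  exists (c / (e * D%:~R)).
  rewrite expr_div_n -tc exprMn eE /y; field.
  by rewrite tF DF.
(* Here t is a square in L and -t = e^2, so -1 would be a square in L. *)
exfalso; have e0 : e != 0 by rewrite -sqrf_eq0 eE oppr_eq0.
apply: (@no_sqrt_minus_one (c%:A / (D%:~R%:A * b) / e%:A)).
rewrite expr_div_n bt -in_algE -rmorphXn eE rmorphN rmorph_int invrN mulrN mulfV //.
by rewrite int_alg -in_algE fmorph_eq0.
Qed.

End QuadraticField.

Theorem proposition6p7 (l : nat) (hl : prime l) (hlodd : odd l)
  (d : int) (hdsqf : squarefree d) (hd1 : d <> 1)
  (F : fieldExtType rat) (hFd : generated_by_sqrt d F)
  (hFim : imaginary_quadratic F) (hFcl : has_class_number F l)
  (L : splittingFieldType F) (hL : hilbert_class_field L)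
  (p : nat) (hp : prime p) (hpodd : odd p) (hp8 : p = 3 %[mod 8]) :
  division_algebra (quat (p%:R : L) (2%:R : L)) <->
  legendre (quadratic_disc d) p = 1 \/ (d = 1 %[mod 8])%Z.
Proof.
have [s sqr_s gen_s] := hFd; have [dimF _] := hFim.
have d_lt0 := imaginary_disc_lt0 sqr_s gen_s dimF hFim.
have [q [hq q4 dq]] :=
  odd_class_number_disc sqr_s gen_s dimF hdsqf d_lt0 hFcl hlodd (prime_gt1 hl).
have [[gal ab unr _] _] := hL.
have natF (n : nat) : (0 < n)%N -> n%:R != 0 :> F.
  by move=> n0; rewrite -(rmorph_nat (in_alg F)) fmorph_eq0 pnatr_eq0 -lt0n.
have natA (n : nat) : n%:R = (n%:R : F)%:A :> L by rewrite -in_algE rmorph_nat.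
have oG := odd_galois_of_no_sqrt (natF 2%N isT)
  (sqrt_descends sqr_s gen_s dimF hdsqf d_lt0 hq q4 dq unr) gal ab.
have two0 : 2 != 0 :> L by rewrite natA -in_algE fmorph_eq0 (natF 2%N isT).
(* q = 3 mod 4 makes d = 1 mod 4. *)
have -> : quadratic_disc d = d.
  by rewrite /quadratic_disc ifT // dq; move: q4; clear; lia.
apply: (iff_trans (division_quat _ two0)).
have [leg1 leg2] := legendre_eq1 d hp.
split=> [nosol|hd [a [b E]]].
- apply: contrapT => h; apply: nosol.
  have nd8 : ~ (d = 1 %[mod 8])%Z by move=> h8; apply: h; right.
  have q8 : q = 3 %[mod 8] by move: q4 nd8; rewrite dq; clear; lia.
  have [|a [b E]] := quad_norm2_nonsplit sqr_s gen_s dimF hp hq dq hp8 q8.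
  - have [pd|pd] := boolP (p %| d)%Z.
      by left; move: pd; rewrite dq dvdzE abszN /= dvdn_prime2 // => /eqP.
    by right=> sq; apply: h; left; apply: leg2.
  exists a%:A, b%:A; rewrite [RHS]natA [in LHS](natA 2%N) -E.
  by rewrite !expr2 -!in_algE rmorphB !rmorphM.
- rewrite natA in E; have [|a' [b' E']] := norm2_descends gal oG _ E.
    exact: natF (prime_gt0 hp).
  apply: (quad_no_norm2 sqr_s gen_s dimF hp hpodd hp8); last by exists a', b'.
  by case: hd => hd; [left; apply: leg1 | right].
Qed.
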